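(* Let $m,n$ be positive integers. For $\sigma,\rho\in\mathfrak{S}_{m+n}$, there is an isomorphism of $H_m(0)\otimes H_n(0)$-modules $$\mathsf{B}(\sigma,\rho)\downarrow^{H_{m+n}(0)}_{H_m(0)\otimes H_n(0)}\;\cong\;\bigoplus_{J\in\mathscr{S}^{(m)}_{\sigma,\rho}}\mathsf{B}\big((\sigma_J)_{\le m},(\rho^J)_{\le m}\big)\otimes\mathsf{B}\big((\sigma_J)_{>m},(\rho^J)_{>m}\big).$$
   Context: Permutations are composed as functions; $s_i=(i,i+1)$; $\ell$ is the Coxeter length; $w_0$ is the longest element of $\mathfrak{S}_{m+n}$; $\mathrm{Des}_L(\sigma)=\{i\mid \ell(s_i\sigma)<\ell(\sigma)\}$. Left weak Bruhat order: $\sigma\preceq_L\rho$ iff $\rho=\gamma\sigma$ with $\ell(\rho)=\ell(\gamma)+\ell(\sigma)$ for some $\gamma$; $[\sigma,\rho]_L=\{\gamma\mid\sigma\preceq_L\gamma\preceq_L\rho\}$ (possibly empty). $H_N(0)$ is the unital $\mathbb{C}$-algebra generated by $\pi_1,\dots,\pi_{N-1}$ with relations $\pi_i^2=\pi_i$, $\pi_i\pi_{i+1}\pi_i=\pi_{i+1}\pi_i\pi_{i+1}$, $\pi_i\pi_j=\pi_j\pi_i$ for $|i-j|\ge2$. $H_m(0)\otimes H_n(0)$ is viewed as the subalgebra of $H_{m+n}(0)$ generated by $\{\pi_i\mid i\in[m+n-1]\setminus\{m\}\}$ ($\pi_i\otimes 1\mapsto\pi_i$, $1\otimes\pi_j\mapsto\pi_{m+j}$),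 and $\downarrow$ denotes restriction. For $\sigma,\rho\in\mathfrak{S}_N$, $\mathsf{B}(\sigma,\rho)$ is the left $H_N(0)$-module with basis $[\sigma,\rho]_L$ and action: $\pi_i\cdot\gamma=\gamma$ if $i\in\mathrm{Des}_L(\gamma)$; $0$ if $i\notin\mathrm{Des}_L(\gamma)$ and $s_i\gamma\notin[\sigma,\rho]_L$; $s_i\gamma$ if $i\notin\mathrm{Des}_L(\gamma)$ and $s_i\gamma\in[\sigma,\rho]_L$. For $\sigma,\rho\in\mathfrak{S}_{m+n}$, $\mathscr{S}^{(m)}_{\sigma,\rho}$ is the set of $m$-element subsets $J\subseteq[m+n]$ such that $J=\gamma^{-1}([1,m])$ for some $\gamma\in[\sigma,\rho]_L$. For an $m$-element subset $J=\{j_1<\cdots<j_m\}$ with complement $[m+n]\setminus J=\{j^{\mathrm c}_1<\cdots<j^{\mathrm c}_n\}$, define $\mathrm{perm}_J,\mathrm{perm}^J\in\mathfrak{S}_{m+n}$ by $\mathrm{perm}_J(j_k)=k$, $\mathrm{perm}_J(j^{\mathrm c}_s)=m+s$, and $\mathrm{perm}^J(j_k)=m-k+1$, $\mathrm{perm}^J(j^{\mathrm c}_s)=m+n-s+1$ ($1\le k\le m$, $1\le s\le n$). With $\gamma\cdot J:=\gamma(J)$, put $\sigma_J:=\mathrm{perm}_{\sigma\cdot J}\,\sigma$ and $\rho^J:=\mathrm{perm}^{(w_0\rho)\cdot J}\,w_0\rho$. For $\gamma\in\mathfrak{S}_{m+n}$ with $\gamma^{-1}([1,m])=\{i_1<\cdots<i_m\}$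 and $\gamma^{-1}([m+1,m+n])=\{i'_1<\cdots<i'_n\}$, the permutations $\gamma_{\le m}\in\mathfrak{S}_m$ and $\gamma_{>m}\in\mathfrak{S}_n$ are $\gamma_{\le m}(j)=\gamma(i_j)$ and $\gamma_{>m}(j)=\gamma(i'_j)-m$. *)

(* Defs.v *)
From HB Require Import structures.
From mathcomp Require Import all_boot all_order all_fingroup all_algebra.
From mathcomp Require Import generic_quotient.
From mathcomp Require Import boolp.
From mathcomp Require Import zify.
Set Implicit Arguments. Unset Strict Implicit. Unset Printing Implicit Defensive.
Import GRing.Theory.
Local Open Scope nat_scope.

(* Indices are 0-based: the letter i of {1, ..., N} is the ordinal i-1 of     *)
(* 'I_N, and the generators s_i and pi_i (1 <= i <= N-1) are indexed by the   *)
(* ordinal i-1 of 'I_N.-1.                                                    *)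

(* In MathComp, (s * t) x = t (s x); here s \po t is x |-> s (t x). *)
Notation "s \po t" := ((t * s)%g)
  (at level 40, left associativity, only parsing).

Section Permutations.
Variable N : nat.
Implicit Types (g h : 'S_N) (i j : 'I_N.-1).

Lemma gen_lo_subproof i : i < N. Proof. by have := ltn_ord i; lia. Qed.
Lemma gen_hi_subproof i : i.+1 < N. Proof. by have := ltn_ord i; lia. Qed.

Definition gen_lo i : 'I_N := Ordinal (gen_lo_subproof i).
Definition gen_hi i : 'I_N := Ordinal (gen_hi_subproof i).
Definition sgen i : 'S_N := tperm (gen_lo i) (gen_hi i).

Definition word_prod (w : seq 'I_N.-1) : 'S_N :=
  foldr (fun i g => sgen i \po g) 1%g w.

Lemma sgenE i (x : 'I_N) :
  val (sgen i x) = if val x == i then i.+1 else if val x == i.+1 then val i else x.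
Proof.
rewrite /sgen permE /= -!val_eqE /=.
by case: ifP => // _; case: ifP.
Qed.

Lemma sgenK i g : sgen i \po (sgen i \po g) = g.
Proof. by rewrite -mulgA tperm2 mulg1. Qed.

Definition invset g : {set 'I_N * 'I_N} :=
  [set p : 'I_N * 'I_N | (p.1 < p.2) && (g p.2 < g p.1)].
Definition ninv g := #|invset g|.

(* i occurs after i+1 in the one-line notation of g *)
Definition pdes g i := (g^-1%g (gen_hi i) < g^-1%g (gen_lo i)).

Lemma pdes_sgen g i : pdes (sgen i \po g) i = ~~ pdes g i.
Proof.
rewrite /pdes invMg tpermV !permM tpermL tpermR.
have : val (g^-1%g (gen_lo i)) <> val (g^-1%g (gen_hi i)).
  by move=> /val_inj/perm_inj/(congr1 val) /=; lia.
by rewrite -leqNgt ltn_neqAle => /eqP ->.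
Qed.

Lemma ninv_up g i : ~~ pdes g i -> ninv (sgen i \po g) = (ninv g).+1.
Proof.
rewrite /pdes -leqNgt => le.
pose a := g^-1%g (gen_lo i); pose b := g^-1%g (gen_hi i).
have ga : g a = gen_lo i by rewrite permKV.
have gb : g b = gen_hi i by rewrite permKV.
have nab : val a <> val b.
  move=> /val_inj ab; move: ga; rewrite ab gb => /(congr1 val) /=; lia.
have ab : a < b by move: le nab; rewrite -/a -/b /=; lia.
have nin : (a, b) \notin invset g by rewrite inE /= ga gb /= ab /=; lia.
rewrite /ninv -add1n -(_ : #|(a, b) |: invset g| = 1 + #|invset g|); last first.
  by rewrite cardsU1 nin.
congr #|pred_of_set _|; apply/setP => -[x y]; rewrite !inE /= xpair_eqE.
rewrite !permM !sgenE.
have xa : (x == a) = (val (g x) == val i).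
  by rewrite -(inj_eq (@perm_inj _ g)) ga -val_eqE.
have xb : (x == b) = (val (g x) == i.+1).
  by rewrite -(inj_eq (@perm_inj _ g)) gb -val_eqE.
have ya : (y == a) = (val (g y) == val i).
  by rewrite -(inj_eq (@perm_inj _ g)) ga -val_eqE.
have yb : (y == b) = (val (g y) == i.+1).
  by rewrite -(inj_eq (@perm_inj _ g)) gb -val_eqE.
have xy : (x == y) = (val (g x) == val (g y)).
  by rewrite val_eqE (inj_eq (@perm_inj _ g)).
rewrite xa yb.
case: (ltnP x y) => hxy; last first.
  apply/esym/negbTE/negP; rewrite orbF -xa -yb => /andP [/eqP ex /eqP ey].
  by move: hxy; rewrite ex ey leqNgt ab.
have {xy} nxy : val (g x) != val (g y) by rewrite -xy; apply/eqP => e; rewrite e ltnn in hxy.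
have nba : ~~ ((val (g x) == i.+1) && (val (g y) == val i)).
  apply/negP; rewrite -xb -ya => /andP [/eqP ex /eqP ey].
  by move: hxy; rewrite ex ey; lia.
move: nxy nba; rewrite /=; clear.
move: (nat_of_ord (g x)) (nat_of_ord (g y)) (nat_of_ord i) => p q r.
by do ! case: eqP => //=; move=> *; lia.
Qed.

Lemma ninv_down g i : pdes g i -> ninv g = (ninv (sgen i \po g)).+1.
Proof.
move=> d; rewrite -{1}(sgenK i g); apply: ninv_up.
by rewrite pdes_sgen d.
Qed.

Lemma ninv1 : ninv 1 = 0.
Proof.
apply/eqP; rewrite cards_eq0; apply/eqP/setP => -[x y].
by rewrite !inE /= !perm1; lia.
Qed.

Lemma no_pdes g : (forall i, ~~ pdes g i) -> g = 1%g.
Proof.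
move=> nd; suff e : forall x : 'I_N, g^-1%g x = x.
  by apply: invg_inj; rewrite invg1; apply/permP => x; rewrite e perm1.
pose f k := if insub k is Some x then val (g^-1%g x) else k.
have fE (x : 'I_N) : f x = g^-1%g x by rewrite /f valK.
have f_lt k : k < N -> f k < N.
  by rewrite /f; case: insubP => [x _ _ _|/negbTE->//]; exact: ltn_ord.
have f_mono k : k.+1 < N -> f k < f k.+1.
  move=> hk; have hi : k < N.-1 by lia.
  have := nd (Ordinal hi); rewrite /pdes -!fE /= -leqNgt => le.
  rewrite ltn_neqAle le andbT; apply/eqP.
  have k0 : k < N by lia.
  rewrite (fE (Ordinal k0)) (fE (Ordinal hk)).
  by move=> /val_inj/perm_inj/(congr1 val) /=; lia.
have f_ge k : k < N -> k <= f k.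
  elim: k => // k IH hk; have := IH (ltnW hk); have := f_mono _ hk; lia.
have f_le d k : k + d = N.-1 -> k < N -> f k + d <= N.-1.
  elim: d k => [|d IH] k hk kN; first by have := f_lt _ kN; lia.
  have h : k.+1 < N by lia.
  by have := IH k.+1 ltac:(lia) h; have := f_mono _ h; lia.
move=> x; apply: val_inj => /=; rewrite -fE.
have xN := ltn_ord x; have := f_ge x xN; have := f_le (N.-1 - x) x; lia.
Qed.

Lemma reduced_word g : exists w : (ninv g).-tuple 'I_N.-1, word_prod w = g.
Proof.
move e: (ninv g) => k; elim: k g e => [|k IH] g e.
  exists [tuple] => /=; apply/esym/no_pdes => i; apply/negP => /ninv_down.
  by rewrite e.
have [i di] : exists i, pdes g i.
  apply/existsP; case: (boolP [exists i, pdes g i]) => // /existsPn /no_pdes g1.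
  by move: e; rewrite g1 ninv1.
have [|w wE] := IH (sgen i \po g); first by move: (ninv_down di); rewrite e => -[].
by exists [tuple of i :: w]; rewrite /= wE sgenK.
Qed.

Lemma word_exists g :
  exists k, [exists w : k.-tuple 'I_N.-1, word_prod w == g].
Proof.
have [w e] := reduced_word g.
by exists (ninv g); apply/existsP; exists w; apply/eqP.
Qed.

(* the least length of a word in the s_i with product g *)
Definition len g : nat := ex_minn (word_exists g).

Definition DesL g : {set 'I_N.-1} := [set i | len (sgen i \po g) < len g].

Definition leL g h : bool :=
  [exists c : 'S_N, (h == c \po g) && (len h == len c + len g)].

Definition intervalL g h : {set 'S_N} := [set c | leL g c && leL c h].

(* see len_w0_max *)
Definition w0 : 'S_N := perm (@rev_ord_inj N).

Lemma ninv_word (w : seq 'I_N.-1) : ninv (word_prod w) <= size w.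
Proof.
elim: w => [|i w IH] /=; first by rewrite ninv1.
case: (boolP (pdes (word_prod w) i)) => [/ninv_down|/ninv_up]; lia.
Qed.

Lemma lenE g : len g = ninv g.
Proof.
rewrite /len; case: ex_minnP => k /existsP [w /eqP wE] kmin.
apply/eqP; rewrite eqn_leq; apply/andP; split.
  by apply: kmin; have [w' e] := reduced_word g; apply/existsP; exists w'; apply/eqP.
by rewrite -wE (leq_trans (ninv_word w)) // size_tuple.
Qed.

Lemma DesLE g i : (i \in DesL g) = pdes g i.
Proof.
rewrite inE !lenE; case: (boolP (pdes g i)) => [/ninv_down ->|/ninv_up ->].
  by rewrite ltnSn.
by rewrite ltnNge leqnSn.
Qed.

Lemma len_w0_max g : g != w0 -> len g < len w0.
Proof.
move=> ng; rewrite !lenE.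
have w0E (x : 'I_N) : val (w0 x) = N - x.+1 by rewrite permE.
apply: proper_card; rewrite properEneq; apply/andP; split; last first.
  apply/subsetP => -[x y]; rewrite !inE /= => /andP [xy _]; rewrite xy /=.
  by rewrite !w0E; have := ltn_ord x; have := ltn_ord y; lia.
apply: contra ng => /eqP e.
suff h : (w0 \po g = 1)%g.
  have -> : g = w0^-1%g by apply/eqP; rewrite eq_mulgV1 invgK h.
  apply/eqP/permP => x; apply: (@perm_inj _ w0); rewrite permKV.
  by apply: val_inj; rewrite !permE rev_ordK.
suff mono (i : 'I_N.-1) : ~~ pdes (w0 \po g)^-1%g i.
  by apply: invg_inj; rewrite invg1; exact: no_pdes.
rewrite /pdes invgK !permM !w0E.
have : (gen_lo i, gen_hi i) \in invset g.
  rewrite e inE /= ltnSn !w0E /=.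
  by have := ltn_ord (gen_hi i); rewrite /=; lia.
rewrite inE /=.
have := ltn_ord (g (gen_hi i)); have := ltn_ord (g (gen_lo i)); lia.
Qed.

Lemma len1 : len 1 = 0. Proof. by rewrite lenE ninv1. Qed.

Lemma word_prod_cat v w : word_prod (v ++ w) = word_prod v \po word_prod w.
Proof. by elim: v => [|i v IH] /=; rewrite ?mulg1 // IH mulgA. Qed.

Lemma len_sub g h : len (g \po h) <= len g + len h.
Proof.
rewrite !lenE.
have [v ve] := reduced_word g; have [w we] := reduced_word h.
have := ninv_word (v ++ w).
by rewrite word_prod_cat ve we size_cat !size_tuple.
Qed.

Lemma leL_refl g : leL g g.
Proof. by apply/existsP; exists 1%g; rewrite mulg1 len1 !eqxx. Qed.

Lemma leL_trans : transitive leL.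
Proof.
move=> h g k /existsP [c /andP [/eqP e /eqP l]] /existsP [d /andP [/eqP f /eqP q]].
apply/existsP; exists (d \po c)%g.
have ke : k = (d \po c) \po g by rewrite f e mulgA.
rewrite -ke eqxx /=.
have s1 := len_sub d c; have := len_sub (d \po c) g; rewrite -ke => s2.
by rewrite eqn_leq s2 q l addnA leq_add2r s1.
Qed.

Definition dem i g := if i \in DesL g then g else sgen i \po g.

Lemma leL_dem i g : leL g (dem i g).
Proof.
rewrite /dem DesLE; case: ifPn => d; first exact: leL_refl.
apply/existsP; exists (sgen i); rewrite eqxx /= !lenE (ninv_up d).
suff -> : ninv (sgen i) = 1 by rewrite add1n.
rewrite -(mul1g (sgen i)) ninv_up ?ninv1 //.
by rewrite /pdes invg1 !perm1 /=; lia.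
Qed.

Lemma dem_idem i g : dem i (dem i g) = dem i g.
Proof.
rewrite {2 3}/dem DesLE; case: ifPn => d; first by rewrite /dem DesLE d.
by rewrite /dem DesLE pdes_sgen d.
Qed.

Lemma sgen_fix i (x : 'I_N) : val x != i -> val x != i.+1 -> sgen i x = x.
Proof.
by move=> h1 h2; apply: val_inj; rewrite sgenE (negbTE h1) (negbTE h2).
Qed.

Lemma dem_comm i j g : i.+1 < j -> dem i (dem j g) = dem j (dem i g).
Proof.
move=> ij.
have cm : (sgen i * sgen j = sgen j * sgen i)%g.
  apply/permP => x; apply: val_inj; rewrite !permM !sgenE.
  by do ! case: eqP => //=; lia.
have d1 h : pdes (sgen j \po h) i = pdes h i.
  rewrite /pdes invMg tpermV !permM.
  by rewrite !(@sgen_fix j) //= neq_ltn; apply/orP; left; lia.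
have d2 h : pdes (sgen i \po h) j = pdes h j.
  rewrite /pdes invMg tpermV !permM.
  by rewrite !(@sgen_fix i) //= neq_ltn; apply/orP; right; lia.
rewrite /dem !DesLE.
by case: (boolP (pdes g i)) => di; case: (boolP (pdes g j)) => dj;
  rewrite ?d1 ?d2 ?(negbTE di) ?(negbTE dj) ?di ?dj // -!mulgA cm.
Qed.

Lemma dem_braid i j g : j = i.+1 :> nat ->
  dem i (dem j (dem i g)) = dem j (dem i (dem j g)).
Proof.
move=> ij.
have br : (sgen i * sgen j * sgen i = sgen j * sgen i * sgen j)%g.
  apply/permP => x; apply: val_inj; rewrite !permM !sgenE.
  by do ! case: eqP => //=; lia.
pose x := gen_lo i; pose y := gen_hi i; pose z := gen_hi j.
have ye : gen_lo j = y by apply: val_inj.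
have six : sgen i x = y by rewrite tpermL.
have siy : sgen i y = x by rewrite tpermR.
have siz : sgen i z = z by apply: sgen_fix; rewrite /= ij; lia.
have sjx : sgen j x = x by apply: sgen_fix; rewrite /= ij; lia.
have sjy : sgen j y = z by rewrite -ye tpermL.
have sjz : sgen j z = y by rewrite -ye tpermR.
have di h : pdes h i = (h^-1%g y < h^-1%g x) by [].
have dj h : pdes h j = (h^-1%g z < h^-1%g y) by rewrite -ye.
have invi h t : (sgen i \po h)^-1%g t = h^-1%g (sgen i t).
  by rewrite invMg tpermV permM.
have invj h t : (sgen j \po h)^-1%g t = h^-1%g (sgen j t).
  by rewrite invMg tpermV permM.
have xy : val (g^-1%g x) <> val (g^-1%g y).
  by move=> /val_inj/perm_inj/(congr1 val) /=; lia.
have yz : val (g^-1%g y) <> val (g^-1%g z).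
  by move=> /val_inj/perm_inj/(congr1 val) /=; lia.
have xz : val (g^-1%g x) <> val (g^-1%g z).
  by move=> /val_inj/perm_inj/(congr1 val) /=; lia.
have E k h : dem k h = if pdes h k then h else sgen k \po h.
  by rewrite /dem DesLE.
have C (a b : 'I_N) : val a <> val b ->
    ((a < b) = true /\ (b < a) = false) \/ ((a < b) = false /\ (b < a) = true).
  by case: ltngtP => // *; [left|right].
have [[h1 h1']|[h1 h1']] := C _ _ xy; have [[h2 h2']|[h2 h2']] := C _ _ yz;
have [[h3 h3']|[h3 h3']] := C _ _ xz;
try (by exfalso; move: h1 h2 h3 h1' h2' h3'; clear;
  move: (nat_of_ord _) (nat_of_ord _) (nat_of_ord _) => p q r; lia);
repeat match goal with |- context [dem ?k ?h] =>
  lazymatch h with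
  | context [dem] => fail
  | _ => rewrite (E k h) ?di ?dj ?(invi, invj, six, siy, siz, sjx, sjy, sjz)
           ?h1 ?h2 ?h3 ?h1' ?h2' ?h3' end end => //.
by rewrite -!mulgA 2!(mulgA (sgen _)) br.
Qed.

End Permutations.

Section WordPositions.
Variable N : nat.
Implicit Types (s : seq 'I_N) (J : {set 'I_N}).

Lemma pos_subproof s : perm_eq s (enum 'I_N) -> forall x, index x s < N.
Proof.
by move=> h x; rewrite -{2}(size_enum_ord N) -(perm_size h) index_mem (perm_mem h) mem_enum.
Qed.

Definition pos_fun s (h : perm_eq s (enum 'I_N)) (x : 'I_N) : 'I_N :=
  Ordinal (pos_subproof h x).

Lemma pos_inj s (h : perm_eq s (enum 'I_N)) : injective (pos_fun h).
Proof.
move=> x y /(congr1 val) /= e.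
have xs : x \in s by rewrite (perm_mem h) mem_enum.
have ys : y \in s by rewrite (perm_mem h) mem_enum.
by rewrite -(nth_index x xs) e nth_index.
Qed.

(* the permutation sending the k-th entry of s to k *)
Definition pos_perm s (h : perm_eq s (enum 'I_N)) : 'S_N := perm (@pos_inj s h).

Lemma perm_eq_sub J : perm_eq (enum J ++ enum (~: J)) (enum 'I_N).
Proof.
apply: uniq_perm; rewrite ?enum_uniq //.
  rewrite cat_uniq !enum_uniq andbT /=; apply/hasPn => x.
  by rewrite !mem_enum inE.
by move=> x; rewrite mem_cat !mem_enum !inE orbN.
Qed.

Lemma perm_eq_sup J : perm_eq (rev (enum J) ++ rev (enum (~: J))) (enum 'I_N).
Proof. by apply: perm_trans (perm_eq_sub J); apply: perm_cat; rewrite perm_rev. Qed.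

(* perm_J and perm^J for m = #|J|: enum J lists J increasingly, so perm_sub   *)
(* sends j_1, ..., j_m, j^c_1, ..., j^c_n to 1, ..., m+n, and perm_sup sends  *)
(* j_m, ..., j_1, j^c_n, ..., j^c_1 to 1, ..., m+n.                           *)
Definition perm_sub J : 'S_N := pos_perm (perm_eq_sub J).
Definition perm_sup J : 'S_N := pos_perm (perm_eq_sup J).

Definition sigma_sub (sigma : 'S_N) J : 'S_N := perm_sub (sigma @: J) \po sigma.

Definition rho_sup (rho : 'S_N) J : 'S_N :=
  perm_sup ((w0 N \po rho) @: J) \po (w0 N \po rho).

End WordPositions.

Section Blocks.
Variables m n : nat.
Implicit Types g : 'S_(m + n).

Definition low : {set 'I_(m + n)} := [set x : 'I_(m + n) | x < m].
Definition high : {set 'I_(m + n)} := [set x : 'I_(m + n) | m <= x].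

Definition Sset (sigma rho : 'S_(m + n)) : {set {set 'I_(m + n)}} :=
  [set J : {set 'I_(m + n)} | (#|J| == m) &&
     [exists g, (g \in intervalL sigma rho) && (J == g @^-1: low)]].

Lemma card_low_preim g : m = #|g @^-1: low|.
Proof.
rewrite card_preimset; last exact: perm_inj.
suff -> : low = [set lshift n i | i : 'I_m].
  by rewrite card_imset ?card_ord //; exact: lshift_inj.
apply/setP => x; rewrite inE; apply/idP/imsetP => [h|[i _ ->]] //=.
by exists (Ordinal h) => //; apply: val_inj.
Qed.

Lemma card_high_preim g : n = #|g @^-1: high|.
Proof.
have -> : g @^-1: high = ~: (g @^-1: low).
  by apply/setP => x; rewrite !inE leqNgt.
have := cardsC (g @^-1: low); rewrite -card_low_preim card_ord.
by move/addnI.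
Qed.

(* i_j and i'_j; enum_val enumerates a set of ordinals increasingly *)
Definition low_pos g (j : 'I_m) : 'I_(m + n) :=
  enum_val (cast_ord (card_low_preim g) j).
Definition high_pos g (j : 'I_n) : 'I_(m + n) :=
  enum_val (cast_ord (card_high_preim g) j).

Lemma perm_le_subproof g j : g (low_pos g j) < m.
Proof. by have := enum_valP (cast_ord (card_low_preim g) j); rewrite !inE. Qed.

Lemma high_posP g j : m <= g (high_pos g j).
Proof. by have := enum_valP (cast_ord (card_high_preim g) j); rewrite !inE. Qed.

Lemma perm_gt_subproof g j : g (high_pos g j) - m < n.
Proof. by rewrite ltn_subLR ?high_posP // ltn_ord. Qed.

Definition perm_le_fun g (j : 'I_m) : 'I_m := Ordinal (perm_le_subproof g j).
Definition perm_gt_fun g (j : 'I_n) : 'I_n := Ordinal (perm_gt_subproof g j).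

Lemma perm_le_inj g : injective (perm_le_fun g).
Proof.
move=> x y /(congr1 val) /= /val_inj/perm_inj.
by move=> /enum_val_inj/cast_ord_inj.
Qed.

Lemma perm_gt_inj g : injective (perm_gt_fun g).
Proof.
move=> x y /(congr1 val) /= e.
have /val_inj/perm_inj : val (g (high_pos g x)) = val (g (high_pos g y)).
  by rewrite /= -(subnK (high_posP g x)) e subnK // high_posP.
by move=> /enum_val_inj/cast_ord_inj.
Qed.

Definition perm_le g : 'S_m := perm (@perm_le_inj g).
Definition perm_gt g : 'S_n := perm (@perm_gt_inj g).

End Blocks.

Local Open Scope ring_scope.
Local Open Scope quotient_scope.

(* H_N(0): expressions in scalars and the pi_i, modulo the least congruence   *)
(* containing the axioms of a unital K-algebra and the defining relations.    *)
Inductive hterm (K : Type) (N : nat) : Type :=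
| HGen of 'I_N.-1
| HCst of K
| HAdd of hterm K N & hterm K N
| HMul of hterm K N & hterm K N.
Arguments HGen {K N} _.
Arguments HCst {K N} _.

HB.instance Definition _ K N := gen_eqMixin (hterm K N).
HB.instance Definition _ K N := gen_choiceMixin (hterm K N).

Inductive hrel (K : fieldType) (N : nat) : hterm K N -> hterm K N -> Prop :=
| hrel_refl a : hrel a a
| hrel_sym a b : hrel a b -> hrel b a
| hrel_trans a b c : hrel a b -> hrel b c -> hrel a c
| hrel_add a a' b b' : hrel a a' -> hrel b b' -> hrel (HAdd a b) (HAdd a' b')
| hrel_mul a a' b b' : hrel a a' -> hrel b b' -> hrel (HMul a b) (HMul a' b')
| hrel_addA a b c : hrel (HAdd a (HAdd b c)) (HAdd (HAdd a b) c)
| hrel_addC a b : hrel (HAdd a b) (HAdd b a)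
| hrel_add0 a : hrel (HAdd (HCst 0) a) a
| hrel_addN a : hrel (HAdd (HMul (HCst (-1)) a) a) (HCst 0)
| hrel_mulA a b c : hrel (HMul a (HMul b c)) (HMul (HMul a b) c)
| hrel_mul1l a : hrel (HMul (HCst 1) a) a
| hrel_mul1r a : hrel (HMul a (HCst 1)) a
| hrel_mulDl a b c : hrel (HMul (HAdd a b) c) (HAdd (HMul a c) (HMul b c))
| hrel_mulDr a b c : hrel (HMul a (HAdd b c)) (HAdd (HMul a b) (HMul a c))
| hrel_cstD x y : hrel (HCst (x + y)) (HAdd (HCst x) (HCst y))
| hrel_cstM x y : hrel (HCst (x * y)) (HMul (HCst x) (HCst y))
| hrel_cstC x a : hrel (HMul (HCst x) a) (HMul a (HCst x))
| hrel_idem (i : 'I_N.-1) : hrel (HMul (HGen i) (HGen i)) (HGen i)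
| hrel_braid (i j : 'I_N.-1) : j = i.+1 :> nat ->
    hrel (HMul (HMul (HGen i) (HGen j)) (HGen i))
         (HMul (HMul (HGen j) (HGen i)) (HGen j))
| hrel_comm (i j : 'I_N.-1) : (i.+1 < j)%N ->
    hrel (HMul (HGen i) (HGen j)) (HMul (HGen j) (HGen i)).

Section HeckeAlgebra.
Variables (K : fieldType) (N : nat).
Local Notation term := (hterm K N).

Definition hrelb : rel term := fun a b => `[< hrel a b >].

Lemma hrelb_equiv : equiv_class_of hrelb.
Proof.
split=> [a|a b|b a c]; rewrite /hrelb.
- by apply/asboolP; exact: hrel_refl.
- by apply/asboolP/asboolP; exact: hrel_sym.
by move=> /asboolP h1 /asboolP h2; apply/asboolP; exact: hrel_trans h1 h2.
Qed.

Canonical hrel_equiv := EquivRelPack hrelb_equiv.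

Definition hecke : Type := {eq_quot hrel_equiv}.
HB.instance Definition _ : EqQuotient _ hrel_equiv hecke := EqQuotient.on hecke.
HB.instance Definition _ := Choice.on hecke.

Lemma heckeP (a b : term) : hrel a b -> \pi_hecke a = \pi_hecke b.
Proof. by move=> h; apply/eqquotP; apply/asboolP. Qed.

Lemma hecke_repr (a : term) : hrel (repr (\pi_hecke a)) a.
Proof.
have : \pi_hecke (repr (\pi_hecke a)) = \pi_hecke a by rewrite reprK.
by move/eqquotP/asboolP.
Qed.

Definition hadd (x y : hecke) : hecke := \pi_hecke (HAdd (repr x) (repr y)).
Definition hmul (x y : hecke) : hecke := \pi_hecke (HMul (repr x) (repr y)).
Definition hcst (c : K) : hecke := \pi_hecke (HCst c).
Definition hopp (x : hecke) : hecke := hmul (hcst (-1)) x.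
Definition hgen (i : 'I_N.-1) : hecke := \pi_hecke (HGen i).

Lemma haddE a b : hadd (\pi_hecke a) (\pi_hecke b) = \pi_hecke (HAdd a b).
Proof. by apply: heckeP; apply: hrel_add; exact: hecke_repr. Qed.

Lemma hmulE a b : hmul (\pi_hecke a) (\pi_hecke b) = \pi_hecke (HMul a b).
Proof. by apply: heckeP; apply: hrel_mul; exact: hecke_repr. Qed.

Lemma hadd_A : associative hadd.
Proof.
elim/quotW=> a; elim/quotW=> b; elim/quotW=> c.
by rewrite (haddE b c) (haddE a b) !haddE; apply/heckeP/hrel_addA.
Qed.

Lemma hadd_C : commutative hadd.
Proof. by elim/quotW=> a; elim/quotW=> b; rewrite !haddE; apply/heckeP/hrel_addC. Qed.

Lemma hadd_0 : left_id (hcst 0) hadd.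
Proof. by elim/quotW=> a; rewrite !haddE; apply/heckeP/hrel_add0. Qed.

Lemma hadd_N : left_inverse (hcst 0) hopp hadd.
Proof. by elim/quotW=> a; rewrite /hopp (hmulE (HCst (-1)) a) haddE; apply/heckeP/hrel_addN. Qed.

HB.instance Definition _ :=
  GRing.isZmodule.Build hecke hadd_A hadd_C hadd_0 hadd_N.

Lemma hmul_A : associative hmul.
Proof.
elim/quotW=> a; elim/quotW=> b; elim/quotW=> c.
by rewrite (hmulE b c) (hmulE a b) !hmulE; apply/heckeP/hrel_mulA.
Qed.

Lemma hmul_1l : left_id (hcst 1) hmul.
Proof. by elim/quotW=> a; rewrite !hmulE; apply/heckeP/hrel_mul1l. Qed.

Lemma hmul_1r : right_id (hcst 1) hmul.
Proof. by elim/quotW=> a; rewrite !hmulE; apply/heckeP/hrel_mul1r. Qed.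

Lemma hmul_Dl : left_distributive hmul hadd.
Proof.
elim/quotW=> a; elim/quotW=> b; elim/quotW=> c.
by rewrite (haddE a b) (hmulE a c) (hmulE b c) hmulE haddE; apply/heckeP/hrel_mulDl.
Qed.

Lemma hmul_Dr : right_distributive hmul hadd.
Proof.
elim/quotW=> a; elim/quotW=> b; elim/quotW=> c.
by rewrite (haddE b c) (hmulE a b) (hmulE a c) hmulE haddE; apply/heckeP/hrel_mulDr.
Qed.

(* the augmentation pi_i |-> 1 shows that 1 <> 0 in H_N(0) *)
Fixpoint haug (t : term) : K :=
  match t with
  | HGen _ => 1
  | HCst c => c
  | HAdd a b => haug a + haug b
  | HMul a b => haug a * haug b
  end.

Lemma haug_rel a b : hrel a b -> haug a = haug b.
Proof.
by elim=> //= *; rewrite ?add0r ?mul1r ?mulr1 ?mulN1r ?addNr ?addrA ?mulrA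
  ?mulrDl ?mulrDr //; congruence || exact: addrC || exact: mulrC.
Qed.

Lemma hcst_neq : hcst 1 != hcst 0.
Proof.
apply/eqP => /eqquotP/asboolP/haug_rel /= /eqP.
by rewrite oner_eq0.
Qed.

HB.instance Definition _ := GRing.Zmodule_isNzRing.Build hecke
  hmul_A hmul_1l hmul_1r hmul_Dl hmul_Dr hcst_neq.

Lemma hcstD x y : hcst (x + y) = hcst x + hcst y.
Proof. by apply/esym; rewrite [LHS]haddE; apply/esym/heckeP/hrel_cstD. Qed.

Lemma hcstM x y : hcst (x * y) = hcst x * hcst y.
Proof. by apply/esym; rewrite [LHS]hmulE; apply/esym/heckeP/hrel_cstM. Qed.

Lemma hcstC x (u : hecke) : hcst x * u = u * hcst x.
Proof.
by elim/quotW: u => a; rewrite [LHS]hmulE [RHS]hmulE; apply/heckeP/hrel_cstC.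
Qed.

Definition hscale (c : K) (x : hecke) : hecke := hcst c * x.

Lemma hscaleA a b v : hscale a (hscale b v) = hscale (a * b) v.
Proof. by rewrite /hscale mulrA hcstM. Qed.
Lemma hscale1 : left_id 1 hscale.
Proof. by move=> v; rewrite /hscale [LHS]mul1r. Qed.
Lemma hscaleDr : right_distributive hscale +%R.
Proof. by move=> a u v; rewrite /hscale mulrDr. Qed.
Lemma hscaleDl v : {morph hscale^~ v : a b / a + b}.
Proof. by move=> a b; rewrite /hscale hcstD mulrDl. Qed.

HB.instance Definition _ := GRing.Zmodule_isLmodule.Build K hecke
  hscaleA hscale1 hscaleDr hscaleDl.

Lemma hscaleAl (a : K) (u v : hecke) : a *: (u * v) = (a *: u) * v.
Proof. exact: mulrA. Qed.
HB.instance Definition _ := GRing.Lmodule_isLalgebra.Build K hecke hscaleAl.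

Lemma hscaleAr (a : K) (u v : hecke) : a *: (u * v) = u * (a *: v).
Proof. by rewrite /GRing.scale /= /hscale mulrA hcstC mulrA. Qed.
HB.instance Definition _ := GRing.Lalgebra_isAlgebra.Build K hecke hscaleAr.

Lemma hcstE c : hcst c = c%:A.
Proof. by rewrite -[LHS]mulr1. Qed.

Lemma hadd_pi a b : \pi_hecke (HAdd a b) = \pi_hecke a + \pi_hecke b.
Proof. by rewrite -haddE. Qed.
Lemma hmul_pi a b : \pi_hecke (HMul a b) = \pi_hecke a * \pi_hecke b.
Proof. by rewrite -hmulE. Qed.

Lemma hecke_ind (P : hecke -> Prop) :
  (forall i, P (hgen i)) -> (forall c, P c%:A) ->
  (forall x y, P x -> P y -> P (x + y)) ->
  (forall x y, P x -> P y -> P (x * y)) -> forall x, P x.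
Proof.
move=> Pg Pc PD PM; elim/quotW; elim=> [i|c|a IHa b IHb|a IHa b IHb].
- exact: Pg.
- by have := Pc c; rewrite -hcstE.
- by rewrite hadd_pi; exact: PD.
by rewrite hmul_pi; exact: PM.
Qed.

Lemma hgen_idem i : hgen i * hgen i = hgen i.
Proof. by rewrite -hmul_pi; apply/heckeP/hrel_idem. Qed.
Lemma hgen_braid (i j : 'I_N.-1) : j = i.+1 :> nat ->
  hgen i * hgen j * hgen i = hgen j * hgen i * hgen j.
Proof.
move=> h; have E a b c : \pi_hecke a * \pi b * \pi c = \pi_hecke (HMul (HMul a b) c).
  by rewrite [RHS]hmul_pi (hmul_pi a b).
by rewrite [LHS]E [RHS]E; apply/heckeP/hrel_braid.
Qed.
Lemma hgen_comm (i j : 'I_N.-1) : (i.+1 < j)%N -> hgen i * hgen j = hgen j * hgen i.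
Proof. by move=> h; rewrite -[LHS]hmul_pi -[RHS]hmul_pi; apply/heckeP/hrel_comm. Qed.

Section Action.
Variables (V : lmodType K) (op : 'I_N.-1 -> V -> V).

Fixpoint hact (t : term) (v : V) : V :=
  match t with
  | HGen i => op i v
  | HCst c => c *: v
  | HAdd a b => hact a v + hact b v
  | HMul a b => hact a (hact b v)
  end.

Definition hecke_act (x : hecke) (v : V) : V := hact (repr x) v.

Hypothesis op_lin : forall i, linear (op i).
Hypothesis op_idem : forall i v, op i (op i v) = op i v.
Hypothesis op_braid : forall (i j : 'I_N.-1) v, j = i.+1 :> nat ->
  op i (op j (op i v)) = op j (op i (op j v)).
Hypothesis op_comm : forall (i j : 'I_N.-1) v, (i.+1 < j)%N -> op i (op j v) = op j (op i v).

Lemma hact_lin t : linear (hact t).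
Proof.
elim: t => [i|c|a IHa b IHb|a IHa b IHb] k u v /=.
- exact: op_lin.
- by rewrite scalerDr !scalerA mulrC.
- by rewrite IHa IHb scalerDr addrACA.
by rewrite IHb IHa.
Qed.

Lemma hactD t u v : hact t (u + v) = hact t u + hact t v.
Proof. by have := hact_lin t 1 u v; rewrite !scale1r. Qed.

Lemma hact0 t : hact t 0 = 0.
Proof. by apply: (addrI (hact t 0)); rewrite -hactD !addr0. Qed.

Lemma hactZ t c v : hact t (c *: v) = c *: hact t v.
Proof. by have := hact_lin t c v 0; rewrite hact0 !addr0. Qed.

Lemma hact_rel a b : hrel a b -> hact a =1 hact b.
Proof.
elim=> //=.
- by move=> ? ? _ h v; rewrite h.
- by move=> ? ? ? _ h1 _ h2 v; rewrite h1 h2.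
- by move=> ? ? ? ? _ h1 _ h2 v; rewrite h1 h2.
- by move=> ? ? ? ? _ h1 _ h2 v; rewrite h1 h2.
- by move=> * v; rewrite /= addrA.
- by move=> * v; rewrite /= addrC.
- by move=> * v; rewrite /= scale0r add0r.
- by move=> * v; rewrite /= scaleN1r addNr scale0r.
- by move=> * v; rewrite /= scale1r.
- by move=> * v; rewrite /= scale1r.
- by move=> * v; rewrite /= hactD.
- by move=> * v; rewrite /= scalerDl.
- by move=> * v; rewrite /= scalerA.
- by move=> * v; rewrite /= hactZ.
- by move=> i j e v; exact: op_braid.
by move=> i j e v; exact: op_comm.
Qed.

Lemma hecke_actE t v : hecke_act (\pi_hecke t) v = hact t v.
Proof. exact: (hact_rel (hecke_repr t)). Qed.

Lemma hecke_actA x y v : hecke_act x (hecke_act y v) = hecke_act (x * y) v.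
Proof.
by elim/quotW: x => a; elim/quotW: y => b; rewrite -hmul_pi !hecke_actE.
Qed.
Lemma hecke_act1 : left_id 1 hecke_act.
Proof. by move=> v; rewrite [LHS]hecke_actE /= scale1r. Qed.
Lemma hecke_actDr : right_distributive hecke_act +%R.
Proof. by elim/quotW=> a u v; rewrite !hecke_actE hactD. Qed.
Lemma hecke_actDl v : {morph hecke_act^~ v : x y / x + y}.
Proof. by elim/quotW=> a; elim/quotW=> b; rewrite -hadd_pi !hecke_actE. Qed.
Lemma hecke_act_gen i v : hecke_act (hgen i) v = op i v.
Proof. exact: hecke_actE. Qed.

End Action.

Section Lift.
Variables (A : algType K) (x : 'I_N.-1 -> A).

Fixpoint heval (t : term) : A :=
  match t with
  | HGen i => x i
  | HCst c => c%:A
  | HAdd a b => heval a + heval b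
  | HMul a b => heval a * heval b
  end.

(* An algebra morphism when the x i satisfy the defining relations. *)
Definition hecke_lift (u : hecke) : A := heval (repr u).

Hypothesis x_idem : forall i, x i * x i = x i.
Hypothesis x_braid : forall i j : 'I_N.-1, j = i.+1 :> nat ->
  x i * x j * x i = x j * x i * x j.
Hypothesis x_comm : forall i j : 'I_N.-1, (i.+1 < j)%N -> x i * x j = x j * x i.

Lemma heval_rel a b : hrel a b -> heval a = heval b.
Proof.
have E t (v : A) : heval t * v = hact (fun i v => x i * v) t v.
  elim: t v => [i|c|s IHs t IHt|s IHs t IHt] v //=; first by rewrite mulr_algl.
    by rewrite mulrDl IHs IHt.
  by rewrite -mulrA IHt IHs.
move=> h; rewrite -(mulr1 (heval a)) -(mulr1 (heval b)) !E.
apply: hact_rel h 1 => [i c u v|i v|i j v e|i j v e].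
- by rewrite mulrDr scalerAr.
- by rewrite mulrA x_idem.
- by rewrite !mulrA x_braid.
by rewrite !mulrA x_comm.
Qed.

Lemma hecke_liftE t : hecke_lift (\pi_hecke t) = heval t.
Proof. exact: (heval_rel (hecke_repr t)). Qed.

Lemma hecke_lift_gen i : hecke_lift (hgen i) = x i.
Proof. exact: hecke_liftE. Qed.
Lemma hecke_liftA c : hecke_lift c%:A = c%:A.
Proof. by rewrite -hcstE hecke_liftE. Qed.
Lemma hecke_liftD : {morph hecke_lift : u v / u + v}.
Proof. by elim/quotW=> a; elim/quotW=> b; rewrite -hadd_pi !hecke_liftE. Qed.
Lemma hecke_liftM : {morph hecke_lift : u v / u * v}.
Proof. by elim/quotW=> a; elim/quotW=> b; rewrite -hmul_pi !hecke_liftE. Qed.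
Lemma hecke_lift1 : hecke_lift 1 = 1.
Proof. by rewrite -(scale1r (1 : hecke)) hecke_liftA scale1r. Qed.
Lemma hecke_liftZ c u : hecke_lift (c *: u) = c *: hecke_lift u.
Proof. by rewrite -mulr_algl hecke_liftM hecke_liftA mulr_algl. Qed.

End Lift.

End HeckeAlgebra.

(* V (x)_K W: formal sums of pairs modulo the least congruence for which      *)
(* addition is commutative and pairing is bilinear.                           *)
Inductive tens_rel (K : fieldType) (V W : lmodType K) :
    seq (V * W) -> seq (V * W) -> Prop :=
| tens_refl s : tens_rel s s
| tens_sym s t : tens_rel s t -> tens_rel t s
| tens_trans s t u : tens_rel s t -> tens_rel t u -> tens_rel s u
| tens_cat s s' t t' : tens_rel s s' -> tens_rel t t' -> tens_rel (s ++ t) (s' ++ t')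
| tens_comm s t : tens_rel (s ++ t) (t ++ s)
| tens_zero w : tens_rel [:: (0, w)] [::]
| tens_addl v v' w : tens_rel [:: (v + v', w)] [:: (v, w); (v', w)]
| tens_addr v w w' : tens_rel [:: (v, w + w')] [:: (v, w); (v, w')]
| tens_scale c v w : tens_rel [:: (c *: v, w)] [:: (v, c *: w)].

Section Tensor.
Variables (K : fieldType) (V W : lmodType K).
Local Notation term := (seq (V * W)).

Definition tens_relb : rel term := fun s t => `[< tens_rel s t >].

Lemma tens_relb_equiv : equiv_class_of tens_relb.
Proof.
split=> [a|a b|b a c]; rewrite /tens_relb.
- by apply/asboolP; exact: tens_refl.
- by apply/asboolP/asboolP; exact: tens_sym.
by move=> /asboolP h1 /asboolP h2; apply/asboolP; exact: tens_trans h1 h2.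
Qed.

Canonical tens_equiv := EquivRelPack tens_relb_equiv.

Definition tens : Type := {eq_quot tens_equiv}.
HB.instance Definition _ : EqQuotient _ tens_equiv tens := EqQuotient.on tens.
HB.instance Definition _ := Choice.on tens.

Lemma tensP (a b : term) : tens_rel a b -> \pi_tens a = \pi_tens b.
Proof. by move=> h; apply/eqquotP; apply/asboolP. Qed.

Lemma tens_repr (a : term) : tens_rel (repr (\pi_tens a)) a.
Proof.
have : \pi_tens (repr (\pi_tens a)) = \pi_tens a by rewrite reprK.
by move/eqquotP/asboolP.
Qed.

Definition tmap (c : K) (s : term) : term := [seq (c *: p.1, p.2) | p <- s].

Definition tadd (x y : tens) : tens := \pi_tens (repr x ++ repr y).
Definition tscale (c : K) (x : tens) : tens := \pi_tens (tmap c (repr x)).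
Definition tzero : tens := \pi_tens [::].
Definition topp (x : tens) : tens := tscale (-1) x.
Definition pure (v : V) (w : W) : tens := \pi_tens [:: (v, w)].

Lemma tmap_rel c s t : tens_rel s t -> tens_rel (tmap c s) (tmap c t).
Proof.
elim=> /= *; rewrite /tmap ?map_cat /= ?scaler0 ?scalerDr.
- exact: tens_refl.
- exact: tens_sym.
- by apply: tens_trans; eassumption.
- exact: tens_cat.
- exact: tens_comm.
- exact: tens_zero.
- exact: tens_addl.
- exact: tens_addr.
by rewrite scalerA mulrC -scalerA; exact: tens_scale.
Qed.

Lemma taddE a b : tadd (\pi_tens a) (\pi_tens b) = \pi_tens (a ++ b).
Proof. by apply: tensP; apply: tens_cat; exact: tens_repr. Qed.

Lemma tscaleE c a : tscale c (\pi_tens a) = \pi_tens (tmap c a).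
Proof. by apply: tensP; apply: tmap_rel; exact: tens_repr. Qed.

Lemma tadd_A : associative tadd.
Proof.
elim/quotW=> a; elim/quotW=> b; elim/quotW=> c.
by rewrite (taddE b c) (taddE a b) !taddE catA.
Qed.

Lemma tadd_C : commutative tadd.
Proof.
elim/quotW=> a; elim/quotW=> b.
by rewrite (taddE a b) (taddE b a); apply/tensP/tens_comm.
Qed.

Lemma tadd_0 : left_id tzero tadd.
Proof. by elim/quotW=> a; rewrite [LHS]taddE. Qed.

Lemma tadd_N : left_inverse tzero topp tadd.
Proof.
elim/quotW=> a; rewrite /topp (tscaleE (-1) a).
have consE p s : \pi_tens (p :: s) = tadd (\pi_tens [:: p]) (\pi_tens s).
  by rewrite taddE.
elim: a => [|[v w] a IH]; first by rewrite [LHS]taddE.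
rewrite [tmap _ _]/= [X in tadd X _]consE [X in tadd _ X]consE.
rewrite -tadd_A [X in tadd _ X]tadd_A [X in tadd _ (tadd X _)]tadd_C.
rewrite -[X in tadd _ X]tadd_A [X in tadd _ (tadd _ X)]IH tadd_A.
rewrite [X in tadd X _]taddE [_ ++ _]/= tadd_C [LHS]tadd_0.
apply: tensP; apply: tens_trans (tens_sym (tens_addl _ _ _)) _.
by rewrite scaleN1r addNr; exact: tens_zero.
Qed.

HB.instance Definition _ :=
  GRing.isZmodule.Build tens tadd_A tadd_C tadd_0 tadd_N.

Lemma tscaleA a b v : tscale a (tscale b v) = tscale (a * b) v.
Proof.
elim/quotW: v => s; rewrite (tscaleE b s) (tscaleE (a * b) s) tscaleE /tmap -map_comp.
by congr (\pi_tens _); apply: eq_map => p /=; rewrite scalerA.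
Qed.

Lemma tscale1 : left_id 1 tscale.
Proof.
elim/quotW=> s; rewrite (tscaleE 1 s); congr (\pi_tens _).
by rewrite -[RHS]map_id; apply: eq_map => -[v w]; rewrite /= scale1r.
Qed.

Lemma tscaleDr : right_distributive tscale +%R.
Proof.
move=> c; elim/quotW=> s; elim/quotW=> t.
rewrite [X in tscale c X]taddE (tscaleE c s) (tscaleE c t) tscaleE.
by rewrite [RHS]taddE /tmap map_cat.
Qed.

Lemma tscaleDl v : {morph tscale^~ v : a b / a + b}.
Proof.
move=> a b; elim/quotW: v => s.
elim: s => [|[v w] s IH].
  by rewrite (tscaleE (a + b)) (tscaleE a) (tscaleE b) [RHS]taddE.
have -> : \pi_tens ((v, w) :: s) = \pi_tens [:: (v, w)] + \pi_tens s :> tens.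
  by rewrite [RHS]taddE.
rewrite !tscaleDr IH addrACA; congr (_ + _).
rewrite (tscaleE (a + b)) (tscaleE a) (tscaleE b) [RHS]taddE /= scalerDl.
exact/tensP/tens_addl.
Qed.

HB.instance Definition _ := GRing.Zmodule_isLmodule.Build K tens
  tscaleA tscale1 tscaleDr tscaleDl.

Lemma pureDl v v' w : pure (v + v') w = pure v w + pure v' w.
Proof. by rewrite [RHS]taddE; apply/tensP/tens_addl. Qed.
Lemma pureDr v w w' : pure v (w + w') = pure v w + pure v w'.
Proof. by rewrite [RHS]taddE; apply/tensP/tens_addr. Qed.
Lemma pureZl c v w : pure (c *: v) w = c *: pure v w.
Proof. by rewrite [RHS]tscaleE. Qed.
Lemma pureZr c v w : pure v (c *: w) = c *: pure v w.
Proof. by rewrite [RHS]tscaleE; apply/esym/tensP/tens_scale. Qed.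

Lemma tens_piE s : \pi_tens s = \sum_(p <- s) pure p.1 p.2.
Proof.
elim: s => [|[v w] s IH]; first by rewrite big_nil.
by rewrite big_cons -IH [RHS]taddE.
Qed.

Lemma tens_ind (P : tens -> Prop) :
  P 0 -> (forall x y, P x -> P y -> P (x + y)) -> (forall v w, P (pure v w)) ->
  forall x, P x.
Proof.
move=> P0 PD Pp; elim/quotW=> s; have -> := tens_piE s.
by elim/big_ind: _ => // p _; exact: Pp.
Qed.

Section Lift.
Variables (U : zmodType) (f : V -> W -> U).

Definition tens_lift (x : tens) : U := \sum_(p <- repr x) f p.1 p.2.

Hypothesis fDl : forall v v' w, f (v + v') w = f v w + f v' w.
Hypothesis fDr : forall v w w', f v (w + w') = f v w + f v w'.
Hypothesis fZ : forall c v w, f (c *: v) w = f v (c *: w).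

Lemma tens_liftE s : tens_lift (\pi_tens s) = \sum_(p <- s) f p.1 p.2.
Proof.
rewrite /tens_lift; move: (repr _) (tens_repr s) => t; elim=> //=.
- by move=> ? ? ? _ -> _ ->.
- by move=> ? ? ? ? _ e1 _ e2; rewrite !big_cat /= e1 e2.
- by move=> ? ?; rewrite !big_cat /= addrC.
- move=> w; rewrite big_seq1 big_nil /=.
  by apply: (addrI (f 0 w)); rewrite -fDl !addr0.
- by move=> v v' w; rewrite !big_cons !big_nil !addr0 /= fDl.
- by move=> v w w'; rewrite !big_cons !big_nil !addr0 /= fDr.
by move=> c v w; rewrite !big_cons !big_nil !addr0 /= fZ.
Qed.

Lemma tens_lift_pure v w : tens_lift (pure v w) = f v w.
Proof. by rewrite tens_liftE big_seq1. Qed.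

Lemma tens_liftD x y : tens_lift (x + y) = tens_lift x + tens_lift y.
Proof.
elim/quotW: x => a; elim/quotW: y => b.
by rewrite [X in tens_lift X]taddE !tens_liftE big_cat.
Qed.

Lemma tens_lift0 : tens_lift 0 = 0.
Proof. by rewrite tens_liftE big_nil. Qed.

End Lift.

End Tensor.

(* (a (x) b) . (v (x) w) = beta1 a v (x) beta2 b w *)
Section TensorPairing.
Variables (K : fieldType) (A B V W V' W' : lmodType K).
Variables (beta1 : A -> V -> V') (beta2 : B -> W -> W').

Definition tens_pair (x : tens A B) (y : tens V W) : tens V' W' :=
  tens_lift (fun a b => tens_lift (fun v w => pure (beta1 a v) (beta2 b w)) y) x.

Hypothesis beta1Dl : forall a a' v, beta1 (a + a') v = beta1 a v + beta1 a' v.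
Hypothesis beta1Dr : forall a v v', beta1 a (v + v') = beta1 a v + beta1 a v'.
Hypothesis beta1Zl : forall c a v, beta1 (c *: a) v = c *: beta1 a v.
Hypothesis beta1Zr : forall c a v, beta1 a (c *: v) = c *: beta1 a v.
Hypothesis beta2Dl : forall b b' w, beta2 (b + b') w = beta2 b w + beta2 b' w.
Hypothesis beta2Dr : forall b w w', beta2 b (w + w') = beta2 b w + beta2 b w'.
Hypothesis beta2Zl : forall c b w, beta2 (c *: b) w = c *: beta2 b w.
Hypothesis beta2Zr : forall c b w, beta2 b (c *: w) = c *: beta2 b w.

Let inner a b (y : tens V W) : tens V' W' :=
  tens_lift (fun v w => pure (beta1 a v) (beta2 b w)) y.

Lemma tens_innerP a b :
  [/\ forall v v' w, pure (beta1 a (v + v')) (beta2 b w) =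
        pure (beta1 a v) (beta2 b w) + pure (beta1 a v') (beta2 b w),
      forall v w w', pure (beta1 a v) (beta2 b (w + w')) =
        pure (beta1 a v) (beta2 b w) + pure (beta1 a v) (beta2 b w') &
      forall c v w, pure (beta1 a (c *: v)) (beta2 b w) =
        pure (beta1 a v) (beta2 b (c *: w))].
Proof.
split=> *; first by rewrite beta1Dr pureDl.
  by rewrite beta2Dr pureDr.
by rewrite beta1Zr beta2Zr pureZl pureZr.
Qed.

Lemma tens_innerD a b x y : inner a b (x + y) = inner a b x + inner a b y.
Proof. by have [h1 h2 h3] := tens_innerP a b; exact: tens_liftD. Qed.
Lemma tens_inner0 a b : inner a b 0 = 0.
Proof. by have [h1 h2 h3] := tens_innerP a b; exact: tens_lift0. Qed.
Lemma tens_inner_pure a b v w : inner a b (pure v w) = pure (beta1 a v) (beta2 b w).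
Proof. by have [h1 h2 h3] := tens_innerP a b; exact: tens_lift_pure. Qed.

Lemma tens_outerP y :
  [/\ forall a a' b, inner (a + a') b y = inner a b y + inner a' b y,
      forall a b b', inner a (b + b') y = inner a b y + inner a b' y &
      forall c a b, inner (c *: a) b y = inner a (c *: b) y].
Proof.
split=> [a a' b|a b b'|c a b].
- elim/tens_ind: y => [|x y hx hy|v w]; first by rewrite !tens_inner0 addr0.
    by rewrite !tens_innerD hx hy addrACA.
  by rewrite !tens_inner_pure beta1Dl pureDl.
- elim/tens_ind: y => [|x y hx hy|v w]; first by rewrite !tens_inner0 addr0.
    by rewrite !tens_innerD hx hy addrACA.
  by rewrite !tens_inner_pure beta2Dl pureDr.
elim/tens_ind: y => [|x y hx hy|v w]; first by rewrite !tens_inner0.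
  by rewrite !tens_innerD hx hy.
by rewrite !tens_inner_pure beta1Zl beta2Zl pureZl pureZr.
Qed.

Lemma tens_pair_pure a b v w :
  tens_pair (pure a b) (pure v w) = pure (beta1 a v) (beta2 b w).
Proof.
have [h1 h2 h3] := tens_outerP (pure v w).
by rewrite /tens_pair tens_lift_pure // -/(inner _ _ _) tens_inner_pure.
Qed.

Lemma tens_pairDl x x' y : tens_pair (x + x') y = tens_pair x y + tens_pair x' y.
Proof. by have [h1 h2 h3] := tens_outerP y; exact: tens_liftD. Qed.

Lemma tens_pair0l y : tens_pair 0 y = 0.
Proof. by have [h1 h2 h3] := tens_outerP y; exact: tens_lift0. Qed.

Lemma tens_pairDr x y y' : tens_pair x (y + y') = tens_pair x y + tens_pair x y'.
Proof.
elim/tens_ind: x => [|x x' h h'|a b]; first by rewrite !tens_pair0l addr0.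
  by rewrite !tens_pairDl h h' addrACA.
have [h1 h2 h3] := tens_outerP y; have [h1' h2' h3'] := tens_outerP y'.
have [h1'' h2'' h3''] := tens_outerP (y + y').
by rewrite /tens_pair !tens_lift_pure // -!/(inner _ _ _) tens_innerD.
Qed.

Lemma tens_pair0r x : tens_pair x 0 = 0.
Proof. by apply: (addrI (tens_pair x 0)); rewrite -tens_pairDr !addr0. Qed.

End TensorPairing.

Section TensorAlgebra.
Variables (K : fieldType) (A B : algType K).

Definition atens : Type := tens A B.
HB.instance Definition _ := GRing.Lmodule.on atens.

Definition amul : atens -> atens -> atens :=
  tens_pair (fun a a' : A => a * a') (fun b b' : B => b * b').

Lemma amul_pure a b a' b' :
  amul (pure a b) (pure a' b') = pure (a * a') (b * b').
Proof.
by apply: tens_pair_pure => *; rewrite ?mulrDl ?mulrDr -?scalerAl -?scalerAr.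
Qed.
Lemma amul_Dl : left_distributive amul +%R.
Proof.
by move=> x y z; apply: tens_pairDl => *; rewrite ?mulrDl ?mulrDr -?scalerAl -?scalerAr.
Qed.
Lemma amul_Dr : right_distributive amul +%R.
Proof.
by move=> x y z; apply: tens_pairDr => *; rewrite ?mulrDl ?mulrDr -?scalerAl -?scalerAr.
Qed.
Lemma amul_0l x : amul 0 x = 0.
Proof. by apply: (addrI (amul 0 x)); rewrite -amul_Dl !addr0. Qed.
Lemma amul_0r x : amul x 0 = 0.
Proof. by apply: (addrI (amul x 0)); rewrite -amul_Dr !addr0. Qed.

Lemma amul_A : associative amul.
Proof.
move=> x y z; elim/tens_ind: x => [|x x' h h'|a b]; first by rewrite !amul_0l.
  by rewrite !amul_Dl h h'.
elim/tens_ind: y => [|x x' h h'|a' b']; first by rewrite !(amul_0l,amul_0r).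
  by rewrite !(amul_Dl, amul_Dr) h h'.
elim/tens_ind: z => [|x x' h h'|a'' b'']; first by rewrite !amul_0r.
  by rewrite !amul_Dr h h'.
by rewrite !amul_pure !mulrA.
Qed.

Lemma amul_1l : left_id (pure 1 1) amul.
Proof.
move=> x; elim/tens_ind: x => [|x x' h h'|a b]; first by rewrite amul_0r.
  by rewrite amul_Dr h h'.
by rewrite amul_pure !mul1r.
Qed.

Lemma amul_1r : right_id (pure 1 1) amul.
Proof.
move=> x; elim/tens_ind: x => [|x x' h h'|a b]; first by rewrite amul_0l.
  by rewrite amul_Dl h h'.
by rewrite amul_pure !mulr1.
Qed.

HB.instance Definition _ := GRing.Zmodule_isPzRing.Build atens
  amul_A amul_1l amul_1r amul_Dl amul_Dr.

End TensorAlgebra.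

(* f is a phantom argument: it selects the action a . v = f a *: v *)
Definition restr (A B : pzRingType) (f : {rmorphism A -> B}) (M : lmodType B) : Type :=
  M.

Section Restriction.
Variables (A B : pzRingType) (f : {rmorphism A -> B}) (M : lmodType B).
HB.instance Definition _ := GRing.Zmodule.copy (restr f M) M.
Local Notation restr := (restr f M).

Definition restr_scale (a : A) (v : restr) : restr := (f a : B) *: (v : M).

Lemma restr_scaleA a b v : restr_scale a (restr_scale b v) = restr_scale (a * b) v.
Proof. by rewrite /restr_scale scalerA rmorphM. Qed.
Lemma restr_scale1 : left_id 1 restr_scale.
Proof. by move=> v; rewrite /restr_scale rmorph1 scale1r. Qed.
Lemma restr_scaleDr : right_distributive restr_scale +%R.
Proof. by move=> a u v; rewrite /restr_scale scalerDr. Qed.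
Lemma restr_scaleDl v : {morph restr_scale^~ v : a b / a + b}.
Proof. by move=> a b; rewrite /restr_scale rmorphD scalerDl. Qed.

HB.instance Definition _ := GRing.Zmodule_isLmodule.Build A restr
  restr_scaleA restr_scale1 restr_scaleDr restr_scaleDl.
End Restriction.

Section UnderlyingSpace.
Variables (K : fieldType) (A : algType K) (M : lmodType A).

Definition uspace : lmodType K := restr (in_alg A : {rmorphism K -> A}) M.

Definition uact (a : A) (v : uspace) : uspace := a *: (v : M).

Lemma uactDl a b v : uact (a + b) v = uact a v + uact b v.
Proof. exact: (@scalerDl A M v a b). Qed.
Lemma uactDr a u v : uact a (u + v) = uact a u + uact a v.
Proof. exact: (@scalerDr A M a u v). Qed.
Lemma uactA a b v : uact a (uact b v) = uact (a * b) v.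
Proof. exact: (@scalerA A M a b v). Qed.
Lemma uact1 v : uact 1 v = v.
Proof. exact: (@scale1r A M v). Qed.
Lemma uactA_cst c v : uact c%:A v = c *: v.
Proof. by []. Qed.
Lemma uactZl c a v : uact (c *: a) v = c *: uact a v.
Proof. by rewrite -mulr_algl -uactA uactA_cst. Qed.
Lemma uactZr c a v : uact a (c *: v) = c *: uact a v.
Proof. by rewrite -uactZl -mulr_algr -uactA uactA_cst. Qed.
End UnderlyingSpace.

Section OuterTensor.
Variables (K : fieldType) (A B : algType K) (M : lmodType A) (N : lmodType B).

Definition otens : Type := tens (uspace M) (uspace N).
HB.instance Definition _ := GRing.Zmodule.on otens.

Definition otens_scale : atens A B -> otens -> otens :=
  tens_pair (@uact K A M) (@uact K B N).

Let hyps := (uactDl, uactDr, uactZl, uactZr).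

Lemma otens_scale_pure a b v w :
  otens_scale (pure a b) (pure v w) = pure (uact a v) (uact b w).
Proof. by apply: tens_pair_pure => *; rewrite hyps. Qed.
Lemma otens_scaleDl v : {morph otens_scale^~ v : x y / x + y}.
Proof. by move=> x y; apply: tens_pairDl => *; rewrite hyps. Qed.
Lemma otens_scaleDr : right_distributive otens_scale +%R.
Proof. by move=> x u v; apply: tens_pairDr => *; rewrite hyps. Qed.
Lemma otens_scale0l v : otens_scale 0 v = 0.
Proof. by apply: (addrI (otens_scale 0 v)); rewrite -otens_scaleDl !addr0. Qed.
Lemma otens_scale0r x : otens_scale x 0 = 0.
Proof. by apply: (addrI (otens_scale x 0)); rewrite -otens_scaleDr !addr0. Qed.

Lemma otens_scaleA x y v : otens_scale x (otens_scale y v) = otens_scale (x * y) v.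
Proof.
elim/tens_ind: x => [|x x' h h'|a b]; first by rewrite mul0r !otens_scale0l.
  by rewrite mulrDl !otens_scaleDl h h'.
elim/tens_ind: y => [|x x' h h'|a' b'].
- by rewrite mulr0 !(otens_scale0l, otens_scale0r).
- by rewrite mulrDr !(otens_scaleDl, otens_scaleDr) h h'.
rewrite [_ * _]amul_pure.
elim/tens_ind: v => [|x x' h h'|v w]; first by rewrite !otens_scale0r.
  by rewrite !otens_scaleDr h h'.
by rewrite !otens_scale_pure !uactA.
Qed.

Lemma otens_scale1 : left_id 1 otens_scale.
Proof.
move=> v; elim/tens_ind: v => [|x x' h h'|v w]; first by rewrite otens_scale0r.
  by rewrite otens_scaleDr h h'.
by rewrite [LHS]otens_scale_pure !uact1.
Qed.

HB.instance Definition _ := GRing.Zmodule_isLmodule.Build (atens A B) otens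
  otens_scaleA otens_scale1 otens_scaleDr otens_scaleDl.
End OuterTensor.

Definition dsum (A : pzRingType) (I : finType) (M : I -> lmodType A) : Type :=
  {dffun forall i, M i}.

Section DirectSum.
Variables (A : pzRingType) (I : finType) (M : I -> lmodType A).
Local Notation dsum := (dsum M).
HB.instance Definition _ := Choice.copy dsum {dffun forall i, M i}.

Definition dsum_coord (f : dsum) (i : I) : M i :=
  (f : {dffun forall i, M i}) i.
Definition dsum_mk (f : forall i, M i) : dsum := finfun f.

Lemma dsum_mkE f i : dsum_coord (dsum_mk f) i = f i.
Proof. exact: ffunE. Qed.
Lemma dsumP f g : (forall i, dsum_coord f i = dsum_coord g i) -> f = g.
Proof. by move=> e; apply/ffunP. Qed.

Definition dsum_zero : dsum := dsum_mk (fun=> 0).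
Definition dsum_opp (f : dsum) : dsum := dsum_mk (fun i => - dsum_coord f i).
Definition dsum_add (f g : dsum) : dsum :=
  dsum_mk (fun i => dsum_coord f i + dsum_coord g i).
Definition dsum_scale (a : A) (f : dsum) : dsum :=
  dsum_mk (fun i => a *: dsum_coord f i).

Lemma dsum_addA : associative dsum_add.
Proof. by move=> f g h; apply: dsumP => i; rewrite !dsum_mkE addrA. Qed.
Lemma dsum_addC : commutative dsum_add.
Proof. by move=> f g; apply: dsumP => i; rewrite !dsum_mkE addrC. Qed.
Lemma dsum_add0 : left_id dsum_zero dsum_add.
Proof. by move=> f; apply: dsumP => i; rewrite !dsum_mkE add0r. Qed.
Lemma dsum_addN : left_inverse dsum_zero dsum_opp dsum_add.
Proof. by move=> f; apply: dsumP => i; rewrite !dsum_mkE addNr. Qed.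
HB.instance Definition _ :=
  GRing.isZmodule.Build dsum dsum_addA dsum_addC dsum_add0 dsum_addN.

Lemma dsum_scaleA a b f : dsum_scale a (dsum_scale b f) = dsum_scale (a * b) f.
Proof. by apply: dsumP => i; rewrite !dsum_mkE scalerA. Qed.
Lemma dsum_scale1 : left_id 1 dsum_scale.
Proof. by move=> f; apply: dsumP => i; rewrite !dsum_mkE scale1r. Qed.
Lemma dsum_scaleDr : right_distributive dsum_scale +%R.
Proof. by move=> a f g; apply: dsumP => i; rewrite !dsum_mkE scalerDr. Qed.
Lemma dsum_scaleDl f : {morph dsum_scale^~ f : a b / a + b}.
Proof. by move=> a b; apply: dsumP => i; rewrite !dsum_mkE scalerDl. Qed.
HB.instance Definition _ := GRing.Zmodule_isLmodule.Build A dsum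
  dsum_scaleA dsum_scale1 dsum_scaleDr dsum_scaleDl.
End DirectSum.

Definition module_iso (A : pzRingType) (M N : lmodType A) : Prop :=
  exists f : {linear M -> N}, bijective f.

Section HeckeInclusion.
Variables (K : fieldType) (m n : nat).
Local Notation H := (hecke K (m + n)).

Lemma gen_left_subproof (i : 'I_m.-1) : (i < (m + n).-1)%N.
Proof. by have := ltn_ord i; lia. Qed.
Lemma gen_right_subproof (j : 'I_n.-1) : (m + j < (m + n).-1)%N.
Proof. by have := ltn_ord j; lia. Qed.

Definition gen_left (i : 'I_m.-1) : 'I_(m + n).-1 := Ordinal (gen_left_subproof i).
Definition gen_right (j : 'I_n.-1) : 'I_(m + n).-1 := Ordinal (gen_right_subproof j).

Definition hecke_left : hecke K m -> H := hecke_lift (fun i => hgen K (gen_left i)).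
Definition hecke_right : hecke K n -> H := hecke_lift (fun j => hgen K (gen_right j)).

Fact hecke_left_rels :
  [/\ forall i : 'I_m.-1, hgen K (gen_left i) * hgen K (gen_left i) = hgen K (gen_left i),
      forall i j : 'I_m.-1, j = i.+1 :> nat ->
        hgen K (gen_left i) * hgen K (gen_left j) * hgen K (gen_left i) =
        hgen K (gen_left j) * hgen K (gen_left i) * hgen K (gen_left j) &
      forall i j : 'I_m.-1, (i.+1 < j)%N ->
        hgen K (gen_left i) * hgen K (gen_left j) =
        hgen K (gen_left j) * hgen K (gen_left i)].
Proof.
split=> [i|i j h|i j h]; first exact: hgen_idem; first exact: hgen_braid.
exact: hgen_comm.
Qed.

Fact hecke_right_rels :
  [/\ forall i : 'I_n.-1, hgen K (gen_right i) * hgen K (gen_right i) = hgen K (gen_right i),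
      forall i j : 'I_n.-1, j = i.+1 :> nat ->
        hgen K (gen_right i) * hgen K (gen_right j) * hgen K (gen_right i) =
        hgen K (gen_right j) * hgen K (gen_right i) * hgen K (gen_right j) &
      forall i j : 'I_n.-1, (i.+1 < j)%N ->
        hgen K (gen_right i) * hgen K (gen_right j) =
        hgen K (gen_right j) * hgen K (gen_right i)].
Proof.
split=> [i|i j h|i j h]; first exact: hgen_idem.
  by apply: hgen_braid; rewrite /= h addnS.
by apply: hgen_comm; rewrite /= -addnS ltn_add2l.
Qed.

Lemma hecke_leftD : {morph hecke_left : u v / u + v}.
Proof. by have [h1 h2 h3] := hecke_left_rels; exact: hecke_liftD. Qed.
Lemma hecke_leftM : {morph hecke_left : u v / u * v}.
Proof. by have [h1 h2 h3] := hecke_left_rels; exact: hecke_liftM. Qed.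
Lemma hecke_left1 : hecke_left 1 = 1.
Proof. by have [h1 h2 h3] := hecke_left_rels; exact: hecke_lift1. Qed.
Lemma hecke_leftZ c u : hecke_left (c *: u) = c *: hecke_left u.
Proof. by have [h1 h2 h3] := hecke_left_rels; exact: hecke_liftZ. Qed.
Lemma hecke_left_gen i : hecke_left (hgen K i) = hgen K (gen_left i).
Proof. by have [h1 h2 h3] := hecke_left_rels; exact: hecke_lift_gen. Qed.

Lemma hecke_rightD : {morph hecke_right : u v / u + v}.
Proof. by have [h1 h2 h3] := hecke_right_rels; exact: hecke_liftD. Qed.
Lemma hecke_rightM : {morph hecke_right : u v / u * v}.
Proof. by have [h1 h2 h3] := hecke_right_rels; exact: hecke_liftM. Qed.
Lemma hecke_right1 : hecke_right 1 = 1.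
Proof. by have [h1 h2 h3] := hecke_right_rels; exact: hecke_lift1. Qed.
Lemma hecke_rightZ c u : hecke_right (c *: u) = c *: hecke_right u.
Proof. by have [h1 h2 h3] := hecke_right_rels; exact: hecke_liftZ. Qed.
Lemma hecke_right_gen i : hecke_right (hgen K i) = hgen K (gen_right i).
Proof. by have [h1 h2 h3] := hecke_right_rels; exact: hecke_lift_gen. Qed.

Lemma hecke_left_right_comm u v : hecke_left u * hecke_right v = hecke_right v * hecke_left u.
Proof.
have cA (w : H) (c : K) : w * c%:A = c%:A * w by rewrite mulr_algl mulr_algr.
have lA c : hecke_left c%:A = c%:A by rewrite hecke_leftZ hecke_left1.
have rA c : hecke_right c%:A = c%:A by rewrite hecke_rightZ hecke_right1.
elim/hecke_ind: u => [i|c|x y hx hy|x y hx hy].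
- elim/hecke_ind: v => [j|c|x y hx hy|x y hx hy].
  + rewrite hecke_left_gen hecke_right_gen; apply: hgen_comm => /=.
    by have := ltn_ord i; lia.
  + by rewrite rA cA.
  + by rewrite hecke_rightD mulrDl mulrDr hx hy.
  by rewrite hecke_rightM mulrA hx -mulrA hy mulrA.
- by rewrite lA cA.
- by rewrite hecke_leftD mulrDl mulrDr hx hy.
by rewrite hecke_leftM -mulrA hy mulrA hx mulrA.
Qed.

(* H_m(0) (x) H_n(0) -> H_{m+n}(0), a (x) b |-> hecke_left a * hecke_right b, *)
(* so pi_i (x) 1 |-> pi_i and 1 (x) pi_j |-> pi_{m+j}                         *)
Definition hecke_incl : atens (hecke K m) (hecke K n) -> H :=
  tens_lift (fun a b => hecke_left a * hecke_right b).

Lemma hecke_incl_hyps :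
  [/\ forall a a' b, hecke_left (a + a') * hecke_right b =
        hecke_left a * hecke_right b + hecke_left a' * hecke_right b,
      forall a b b', hecke_left a * hecke_right (b + b') =
        hecke_left a * hecke_right b + hecke_left a * hecke_right b' &
      forall (c : K) a b, hecke_left (c *: a) * hecke_right b =
        hecke_left a * hecke_right (c *: b)].
Proof.
split=> *; first by rewrite hecke_leftD mulrDl.
  by rewrite hecke_rightD mulrDr.
by rewrite hecke_leftZ hecke_rightZ -scalerAl -scalerAr.
Qed.

Lemma hecke_incl_pure a b : hecke_incl (pure a b) = hecke_left a * hecke_right b.
Proof. by have [h1 h2 h3] := hecke_incl_hyps; exact: tens_lift_pure. Qed.
Lemma hecke_inclD x y : hecke_incl (x + y) = hecke_incl x + hecke_incl y.
Proof. by have [h1 h2 h3] := hecke_incl_hyps; exact: tens_liftD. Qed.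
Lemma hecke_incl0 : hecke_incl 0 = 0.
Proof. by have [h1 h2 h3] := hecke_incl_hyps; exact: tens_lift0. Qed.

Lemma hecke_inclM : {morph hecke_incl : x y / x * y}.
Proof.
move=> x y; elim/tens_ind: x => [|x x' h h'|a b].
- by rewrite mul0r !hecke_incl0 mul0r.
- by rewrite mulrDl !hecke_inclD h h' mulrDl.
elim/tens_ind: y => [|x x' h h'|a' b'].
- by rewrite mulr0 !hecke_incl0 mulr0.
- by rewrite mulrDr !hecke_inclD h h' mulrDr.
rewrite [X in hecke_incl X]amul_pure !hecke_incl_pure hecke_leftM hecke_rightM.
by rewrite !mulrA -(mulrA (hecke_left a)) hecke_left_right_comm !mulrA.
Qed.

Lemma hecke_incl1 : hecke_incl 1 = 1.
Proof. by rewrite [LHS]hecke_incl_pure hecke_left1 hecke_right1 mulr1. Qed.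

Fact hecke_incl_nmod : nmod_morphism hecke_incl.
Proof. by split; [exact: hecke_incl0 | exact: hecke_inclD]. Qed.
Fact hecke_incl_monoid : monoid_morphism hecke_incl.
Proof. by split; [exact: hecke_incl1 | exact: hecke_inclM]. Qed.
HB.instance Definition _ :=
  GRing.isNmodMorphism.Build _ _ hecke_incl hecke_incl_nmod.
HB.instance Definition _ :=
  GRing.isMonoidMorphism.Build _ _ hecke_incl hecke_incl_monoid.

End HeckeInclusion.

Section IntervalModule.
Variables (K : fieldType) (N : nat) (sigma rho : 'S_N).
Implicit Types (i j : 'I_N.-1).

Definition interval_type : Type := {g : 'S_N | g \in intervalL sigma rho}.
HB.instance Definition _ := Finite.on interval_type.

(* the K-vector space with basis (Bbasis g), g in [sigma, rho]_L *)
Definition Bspace : lmodType K := {ffun interval_type -> K^o}.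

Definition Bbasis (g : interval_type) : Bspace := [ffun h => (h == g)%:R].

Definition Bpi i (g : interval_type) : Bspace :=
  if i \in DesL (val g) then Bbasis g
  else if insub (sgen i \po val g) is Some h then Bbasis h else 0.

Definition Bop i (v : Bspace) : Bspace := \sum_g v g *: Bpi i g.

Lemma Bop_lin i : linear (Bop i).
Proof.
move=> c u v; rewrite /Bop scaler_sumr -big_split /=.
by apply: eq_bigr => g _; rewrite !ffunE scalerDl scalerA.
Qed.

Lemma BopD i u v : Bop i (u + v) = Bop i u + Bop i v.
Proof. by have := Bop_lin i 1 u v; rewrite !scale1r. Qed.
Lemma Bop0 i : Bop i 0 = 0.
Proof. by apply: (addrI (Bop i 0)); rewrite -BopD !addr0. Qed.
Lemma BopZ i c v : Bop i (c *: v) = c *: Bop i v.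
Proof. by have := Bop_lin i c v 0; rewrite Bop0 !addr0. Qed.

Lemma Bop_basis i g : Bop i (Bbasis g) = Bpi i g.
Proof.
rewrite /Bop (bigD1 g) //= ffunE eqxx scale1r big1 ?addr0 // => h hg.
by rewrite ffunE (negbTE hg) scale0r.
Qed.

Lemma Bbasis_sum v : v = \sum_g v g *: Bbasis g :> Bspace.
Proof.
apply/ffunP => h; rewrite sum_ffunE.
transitivity (\sum_g (v g : K) * (h == g)%:R).
  rewrite (bigD1 h) //= eqxx mulr1 big1 ?addr0 // => g hg.
  by rewrite eq_sym (negbTE hg) mulr0.
by apply: eq_bigr => g _; rewrite !ffunE.
Qed.

Let delta (x : 'S_N) : Bspace := if insub x is Some h then Bbasis h else 0.

Let delta_val g : delta (val g) = Bbasis g.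
Proof. by rewrite /delta valK. Qed.

Let Bpi_delta i g : Bpi i g = delta (dem i (val g)).
Proof. by rewrite /Bpi /dem; case: ifP => _ //; rewrite delta_val. Qed.

Let Bop_delta i x : leL sigma x -> Bop i (delta x) = delta (dem i x).
Proof.
move=> sx; rewrite {1}/delta; case: insubP => [g _ <-|nx].
  by rewrite Bop_basis Bpi_delta.
rewrite Bop0 /delta insubN //; apply: contra nx; rewrite !inE sx /=.
by case/andP=> _; apply: leL_trans; exact: leL_dem.
Qed.

Let sigma_dem i x : leL sigma x -> leL sigma (dem i x).
Proof. by move=> sx; apply: leL_trans sx _; exact: leL_dem. Qed.

Let sigma_val (g : interval_type) : leL sigma (val g).
Proof. by have := valP g; rewrite inE => /andP[]. Qed.

Let comp_lin (f1 f2 : Bspace -> Bspace) :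
  linear f1 -> linear f2 -> linear (f1 \o f2).
Proof. by move=> h1 h2 c u v; rewrite /= h2 h1. Qed.

Let lin_ext (f1 f2 : Bspace -> Bspace) :
  linear f1 -> linear f2 -> (forall g, f1 (Bbasis g) = f2 (Bbasis g)) -> f1 =1 f2.
Proof.
have lin_sum (f : Bspace -> Bspace) : linear f ->
    forall v : Bspace, f v = \sum_g v g *: f (Bbasis g) :> Bspace.
  move=> l v.
  have f0 : f 0 = 0.
    by apply: (addrI (f 0)); have := l 1 0 0; rewrite !scale1r !addr0 => <-.
  rewrite {1}(Bbasis_sum v).
  elim: (index_enum _) => [|g s IH]; first by rewrite !big_nil f0.
  by rewrite !big_cons l IH.
by move=> l1 l2 e v; rewrite !lin_sum //; apply: eq_bigr => g _; rewrite e.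
Qed.

Lemma Bop_idem i v : Bop i (Bop i v) = Bop i v.
Proof.
have h := Bop_lin i.
apply: (lin_ext (comp_lin h h) h) => g /=.
by rewrite Bop_basis Bpi_delta Bop_delta ?dem_idem // sigma_dem.
Qed.

Lemma Bop_braid i j v : j = i.+1 :> nat ->
  Bop i (Bop j (Bop i v)) = Bop j (Bop i (Bop j v)).
Proof.
move=> e; have hi := Bop_lin i; have hj := Bop_lin j.
apply: (lin_ext (comp_lin hi (comp_lin hj hi)) (comp_lin hj (comp_lin hi hj))) => g /=.
by rewrite !Bop_basis !Bpi_delta !Bop_delta ?sigma_dem // (dem_braid _ e).
Qed.

Lemma Bop_comm i j v : (i.+1 < j)%N -> Bop i (Bop j v) = Bop j (Bop i v).
Proof.
move=> e; have hi := Bop_lin i; have hj := Bop_lin j.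
apply: (lin_ext (comp_lin hi hj) (comp_lin hj hi)) => g /=.
by rewrite !Bop_basis !Bpi_delta !Bop_delta ?sigma_dem // (dem_comm _ e).
Qed.

Definition Bmod : Type := Bspace.
HB.instance Definition _ := GRing.Zmodule.on Bmod.

Definition Bscale (x : hecke K N) (v : Bmod) : Bmod := hecke_act Bop x v.

Lemma BscaleA x y v : Bscale x (Bscale y v) = Bscale (x * y) v.
Proof. exact: (hecke_actA Bop_lin Bop_idem Bop_braid Bop_comm). Qed.
Lemma Bscale1 : left_id 1 Bscale.
Proof. exact: (hecke_act1 Bop_lin Bop_idem Bop_braid Bop_comm). Qed.
Lemma BscaleDr : right_distributive Bscale +%R.
Proof. exact: (hecke_actDr Bop_lin Bop_idem Bop_braid Bop_comm). Qed.
Lemma BscaleDl v : {morph Bscale^~ v : x y / x + y}.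
Proof. exact: (hecke_actDl Bop_lin Bop_idem Bop_braid Bop_comm). Qed.

HB.instance Definition _ := GRing.Zmodule_isLmodule.Build (hecke K N) Bmod
  BscaleA Bscale1 BscaleDr BscaleDl.

Lemma Bscale_gen i (g : interval_type) :
  hgen K i *: (Bbasis g : Bmod) = Bpi i g.
Proof.
rewrite -Bop_basis.
exact: (hecke_act_gen Bop_lin Bop_idem Bop_braid Bop_comm).
Qed.

End IntervalModule.

(* Main.v *)
From HB Require Import structures.
Require Import Defs.
From mathcomp Require Import all_boot all_order all_fingroup all_algebra.
From mathcomp Require Import zify.
From mathcomp Require Import reals complex.
Set Implicit Arguments. Unset Strict Implicit. Unset Printing Implicit Defensive.
Import GRing.Theory.

(** The left weak order is the inclusion of inversion sets, where an inversion
is a pair of positions carrying values in the wrong order ([leLE]). Fix a set J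
of m positions. A permutation x whose m smallest values sit at the positions of
J amounts to the pair of patterns (perm_le x, perm_gt x): every such pair
occurs ([perm_with_blocks]) and determines x ([perm_block_inj]). An inversion of
x lies within J, where it is an inversion of perm_le x, or outside J, where it
is an inversion of perm_gt x, or it joins J to its complement, and then it
depends on J alone ([invset_cross]).

Suppose that J comes from some g in the interval from sigma to rho. The inversions of sigma that
join J to its complement are inversions of g, hence of every x with the same J;
dually, those of x are inversions of rho. So such an x lies in the interval
exactly when the inversions of sigma and rho within J bound those of perm_le x
and the inversions outside J bound those of perm_gt x. The permutations
sigma_J and rho^J carry the patterns of sigma and rho on J and on its
complement, so the interval is the disjoint union over J of products of two
intervals ([intervalL_blocks]).

A generator pi_i with i different from m acts on x by exchanging two consecutive
values of the same block. This preserves J and acts on one of the two patterns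
as the corresponding generator of the smaller algebra ([dem_left], [dem_right]).
The map sending the basis vector x to the tensor product of the basis vectors
perm_le x and perm_gt x in the summand J is therefore linear over the tensor product ([equivariant_all]); it is bijective
since it matches bases ([split_mapK], [split_map_surj]). *)

(** * The weak order as inclusion of inversion sets *)

Section WeakOrder.
Variable N : nat.
Implicit Types g h x y : 'S_N.

Lemma invsetP g (i j : 'I_N) : ((i, j) \in invset g) = (i < j) && (g j < g i).
Proof. by rewrite inE. Qed.

Lemma perm_val_neq g (i j : 'I_N) : i < j -> g i <> g j :> nat.
Proof. by move=> ij /val_inj/perm_inj e; rewrite e ltnn in ij. Qed.

(** Two values g i and g j are inverted by h g^-1 exactly when one of g and h
inverts the positions i and j and the other does not, so the inversions of
h g^-1 correspond to the symmetric difference of the inversion sets. *)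
Lemma ninv_quotient g h :
  ninv (h \po g^-1%g) =
  #|invset g :\: invset h| + #|invset h :\: invset g|.
Proof.
pose D := (invset g :\: invset h) :|: (invset h :\: invset g).
(* f sends two positions to the two values that g puts there, sorted. *)
pose f (p : 'I_N * 'I_N) :=
  if g p.1 < g p.2 then (g p.1, g p.2) else (g p.2, g p.1).
have DE i j : ((i, j) \in D) = (i < j) && ((g j < g i) != (h j < h i)).
  rewrite !in_setU !in_setD !invsetP.
  by case: (i < j); case: (g j < g i); case: (h j < h i).
have <- : #|D| = #|invset g :\: invset h| + #|invset h :\: invset g|.
  rewrite cardsU [X in _ - #|pred_of_set X|](_ : _ = set0) ?cards0 ?subn0 //.
  by apply/setP => p; rewrite !in_setI !in_setD in_set0; do 2!case: (p \in _).
have finj : {in D &, injective f}.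
  move=> [i j] [i' j']; rewrite !DE /f /= => /andP[ij _] /andP[ij' _].
  by do 2!case: ifP => _; move=> [] /perm_inj ? /perm_inj ?; subst;
    rewrite // ltnNge ltnW in ij.
rewrite -(card_in_imset finj) /ninv; congr #|pred_of_set _|.
apply/setP => -[a b]; rewrite invsetP !permM.
apply/andP/imsetP => [[ab cba]|[[i j]]].
  pose i := g^-1%g a; pose j := g^-1%g b.
  have gi : g i = a by rewrite permKV.
  have gj : g j = b by rewrite permKV.
  have [ij|ji|/val_inj/perm_inj ij] := ltngtP i j; last by rewrite ij ltnn in ab.
    exists (i, j); last by rewrite /f /= gi gj ab.
    by rewrite DE gi gj ij cba ltnNge (ltnW ab).
  exists (j, i); first by rewrite DE gi gj ji ab ltnNge (ltnW cba).
  by rewrite /f /= gi gj ltnNge (ltnW ab).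
rewrite DE /f /= => /andP[ij ghij].
have := perm_val_neq (g := g) ij; have := perm_val_neq (g := h) ij.
by case: ifP => gij hne gne [-> ->]; rewrite !permK; move: gij ghij hne gne;
  move: (nat_of_ord _) (nat_of_ord _) (nat_of_ord _) (nat_of_ord _) => p q r s; clear; lia.
Qed.

(** The only candidate for the left factor is h g^-1, and by [ninv_quotient] the
lengths add up exactly when no inversion of g is missing from h. *)
Lemma leLE g h : leL g h = (invset g \subset invset h).
Proof.
rewrite -setD_eq0 -cards_eq0.
have -> : leL g h = (len h == len (h \po g^-1%g) + len g).
  apply/existsP/idP => [[c /andP[/eqP-> ]]|e]; first by rewrite mulKg.
  by exists (h \po g^-1%g); rewrite mulKVg eqxx.
rewrite !lenE ninv_quotient /ninv.
have := cardsID (invset h) (invset g); have := cardsID (invset g) (invset h).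
by rewrite setIC; lia.
Qed.

End WeakOrder.

(** * Standardization *)

Lemma index_sorted (T : eqType) (r : rel T) (s : seq T) :
  transitive r -> irreflexive r -> sorted r s ->
  {in s &, forall x y, (index x s < index y s) = r x y}.
Proof.
move=> rT rI rs; have H := sorted_ltn_index rT rs.
move=> x y xs ys; apply/idP/idP => [|rxy]; first exact: H.
rewrite ltnNge leq_eqVlt; apply/negP => /orP[/eqP e|/(H _ _ ys xs) ryx].
  have e' : x = y by rewrite -(nth_index x xs) -e nth_index.
  by rewrite e' rI in rxy.
by have := rT _ _ _ rxy ryx; rewrite rI.
Qed.

Section Monotone.
Variable N : nat.
Implicit Types A : {set 'I_N}.

Lemma sorted_enum A : sorted (fun i j : 'I_N => i < j) (enum A).
Proof.
rewrite {1}/enum_mem -enumT; apply: sorted_filter.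
  by move=> ? ? ?; exact: ltn_trans.
by rewrite -[sorted _ _](@sorted_map _ _ val ltn) val_enum_ord iota_ltn_sorted.
Qed.

Lemma sorted_rev_enum A : sorted (fun i j : 'I_N => j < i) (rev (enum A)).
Proof. by rewrite rev_sorted; exact: sorted_enum. Qed.

Lemma index_enum_mono A : {in A &, forall i j : 'I_N,
  (index i (enum A) < index j (enum A)) = (i < j)}.
Proof.
move=> i j iA jA; apply: (index_sorted _ _ (sorted_enum A)); rewrite ?mem_enum //.
  by move=> ? ? ?; exact: ltn_trans.
by move=> ?; exact: ltnn.
Qed.

Lemma index_rev_enum_mono A : {in A &, forall i j : 'I_N,
  (index i (rev (enum A)) < index j (rev (enum A))) = (j < i)}.
Proof.
move=> i j iA jA; apply: (index_sorted _ _ (sorted_rev_enum A));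
  rewrite ?mem_rev ?mem_enum //; last by move=> ?; exact: ltnn.
by move=> ? ? ? h1 h2; exact: ltn_trans h2 h1.
Qed.

Lemma enum_val_mono A (i j : 'I_#|A|) : (enum_val i < enum_val j) = (i < j).
Proof.
rewrite -(index_enum_mono (enum_valP i) (enum_valP j)).
have x0 := enum_val i.
by rewrite !(enum_val_nth x0) !index_uniq -?cardE ?enum_uniq.
Qed.

(** The permutations perm_sub A and perm_sup A move A in front of its complement.
Within each of the two parts the first keeps and the second reverses the order;
composing the second with w0 restores it. *)
Lemma perm_sub_mono A (i j : 'I_N) : (i \in A) = (j \in A) ->
  (perm_sub A i < perm_sub A j) = (i < j).
Proof.
rewrite !permE /= !index_cat !mem_enum => e; rewrite -e; case: ifPn => iA.
  by rewrite index_enum_mono // -e.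
by rewrite ltn_add2l index_enum_mono // in_setC -?e.
Qed.

Lemma perm_sup_mono A (i j : 'I_N) : (i \in A) = (j \in A) ->
  (perm_sup A i < perm_sup A j) = (j < i).
Proof.
rewrite !permE /= !index_cat !mem_rev !mem_enum => e; rewrite -e; case: ifPn => iA.
  by rewrite index_rev_enum_mono // -e.
by rewrite ltn_add2l index_rev_enum_mono // in_setC -?e.
Qed.

Lemma perm_sub_lt A (i : 'I_N) : (perm_sub A i < #|A|) = (i \in A).
Proof.
rewrite permE /= index_cat mem_enum cardE; case: ifPn => iA.
  by rewrite index_mem mem_enum.
by rewrite ltnNge leq_addr.
Qed.

Lemma perm_sup_lt A (i : 'I_N) : (perm_sup A i < #|A|) = (i \in A).
Proof.
have -> : #|A| = size (rev (enum A)) by rewrite size_rev cardE.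
rewrite permE /= index_cat mem_rev mem_enum; case: ifPn => iA.
  by rewrite index_mem mem_rev mem_enum.
by rewrite ltnNge leq_addr.
Qed.

End Monotone.

(** * Cutting a permutation into its low and high values *)

Section BlockPermutations.
Variables m n : nat.
Implicit Types g h x y : 'S_(m + n).

Lemma low_pos_low x j : x (low_pos x j) = lshift n (perm_le x j).
Proof. by apply: val_inj; rewrite /= permE. Qed.

Lemma high_pos_high x k : x (high_pos x k) = rshift m (perm_gt x k).
Proof. by apply: val_inj; rewrite /= permE /= subnKC // high_posP. Qed.

Lemma low_pos_mono x (j k : 'I_m) : (low_pos x j < low_pos x k) = (j < k).
Proof. by rewrite enum_val_mono. Qed.

Lemma high_pos_mono x (j k : 'I_n) : (high_pos x j < high_pos x k) = (j < k).
Proof. by rewrite enum_val_mono. Qed.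

Lemma high_preimE x : x @^-1: high m n = ~: (x @^-1: low m n).
Proof. by apply/setP => i; rewrite !inE leqNgt. Qed.

Lemma eq_low_pos x y : x @^-1: low m n = y @^-1: low m n -> low_pos x =1 low_pos y.
Proof.
by move=> e j; rewrite /low_pos !(enum_val_nth (low_pos x j)) /= e.
Qed.

Lemma eq_high_pos x y : x @^-1: low m n = y @^-1: low m n -> high_pos x =1 high_pos y.
Proof.
by move=> e k; rewrite /high_pos !(enum_val_nth (high_pos x k)) /= !high_preimE e.
Qed.

Lemma perm_inv_lshift x j : x^-1%g (lshift n j) = low_pos x ((perm_le x)^-1%g j).
Proof. by apply: (@perm_inj _ x); rewrite permKV low_pos_low permKV. Qed.

Lemma perm_inv_rshift x k : x^-1%g (rshift m k) = high_pos x ((perm_gt x)^-1%g k).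
Proof. by apply: (@perm_inj _ x); rewrite permKV high_pos_high permKV. Qed.

(** Case analysis on a position of x that names its rank among the low or the high
ones, so that its value is known from [low_pos_low] or [high_pos_high]. *)
Variant pos_spec x : 'I_(m + n) -> Type :=
| LowPos j : pos_spec x (low_pos x j)
| HighPos k : pos_spec x (high_pos x k).

Lemma block_posP x i : pos_spec x i.
Proof.
rewrite -(permK x i); case: (split_ordP (x i)) => [j|k] ->.
  by rewrite perm_inv_lshift; exact: LowPos.
by rewrite perm_inv_rshift; exact: HighPos.
Qed.

(** Since low_pos is increasing, passing to the pattern keeps relative orders of
positions as well as of values. *)
Lemma invset_perm_le x j k :
  ((j, k) \in invset (perm_le x)) = ((low_pos x j, low_pos x k) \in invset x).
Proof. by rewrite !invsetP low_pos_mono !low_pos_low. Qed.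

Lemma invset_perm_gt x j k :
  ((j, k) \in invset (perm_gt x)) = ((high_pos x j, high_pos x k) \in invset x).
Proof. by rewrite !invsetP high_pos_mono !high_pos_high /= ltn_add2l. Qed.

Lemma perm_block_inj x y : x @^-1: low m n = y @^-1: low m n ->
  perm_le x = perm_le y -> perm_gt x = perm_gt y -> x = y.
Proof.
move=> e el eg; apply/permP => i; case: (block_posP x i) => [j|k].
  by rewrite low_pos_low el (eq_low_pos e) low_pos_low.
by rewrite high_pos_high eg (eq_high_pos e) high_pos_high.
Qed.

(** The embedding of S_m x S_n into S_(m+n) acting on values: composing with it
on the left changes the two patterns and leaves the low positions alone. *)
Definition block_fun (a : 'S_m) (b : 'S_n) (i : 'I_(m + n)) : 'I_(m + n) :=
  match split i with inl j => lshift n (a j) | inr k => rshift m (b k) end.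

Lemma block_fun_inj a b : injective (block_fun a b).
Proof.
move=> i j; rewrite /block_fun.
case: split_ordP => i' ->; case: split_ordP => j' -> /eqP.
- by rewrite eq_lshift => /eqP/perm_inj->.
- by rewrite eq_lrshift.
- by rewrite eq_rlshift.
by rewrite eq_rshift => /eqP/perm_inj->.
Qed.

Definition block_perm a b : 'S_(m + n) := perm (@block_fun_inj a b).

Lemma block_perm_lshift a b j : block_perm a b (lshift n j) = lshift n (a j).
Proof.
rewrite permE /block_fun; case: split_ordP => i /eqP.
  by rewrite eq_lshift => /eqP->.
by rewrite eq_lrshift.
Qed.

Lemma block_perm_rshift a b k : block_perm a b (rshift m k) = rshift m (b k).
Proof.
rewrite permE /block_fun; case: split_ordP => i /eqP.
  by rewrite eq_rlshift.
by rewrite eq_rshift => /eqP->.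
Qed.

Lemma block_preim_low a b x : (block_perm a b \po x) @^-1: low m n = x @^-1: low m n.
Proof.
apply/setP => i; rewrite !inE permM; case: (split_ordP (x i)) => k ->.
  by rewrite block_perm_lshift /= !ltn_ord.
by rewrite block_perm_rshift /= !ltnNge !leq_addr.
Qed.

Lemma perm_le_block a b x : perm_le (block_perm a b \po x) = a \po perm_le x.
Proof.
apply/permP => j; apply: (@lshift_inj m n).
rewrite -low_pos_low (eq_low_pos (block_preim_low a b x)) !permM.
by rewrite low_pos_low block_perm_lshift.
Qed.

Lemma perm_gt_block a b x : perm_gt (block_perm a b \po x) = b \po perm_gt x.
Proof.
apply/permP => j; apply: (@rshift_inj m n).
rewrite -high_pos_high (eq_high_pos (block_preim_low a b x)) !permM.
by rewrite high_pos_high block_perm_rshift.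
Qed.

Lemma perm_with_blocks g (a : 'S_m) (b : 'S_n) :
  exists x, [/\ x @^-1: low m n = g @^-1: low m n, perm_le x = a & perm_gt x = b].
Proof.
exists (block_perm (a \po (perm_le g)^-1%g) (b \po (perm_gt g)^-1%g) \po g).
by rewrite block_preim_low perm_le_block perm_gt_block !mulKVg.
Qed.

(** The generators other than the m-th one lie in S_m x S_n, which is why the
restricted action keeps the low positions. *)
Lemma sgen_left i : sgen (gen_left n i) = block_perm (sgen i) 1 :> 'S_(m + n).
Proof.
apply/permP => x; apply: val_inj; rewrite sgenE; case: (split_ordP x) => k ->.
  by rewrite block_perm_lshift /= sgenE.
rewrite block_perm_rshift perm1 /=; have := ltn_ord i.
by case: eqP => [|_]; [lia|case: eqP => //; lia].
Qed.

Lemma sgen_right i : sgen (gen_right m i) = block_perm 1 (sgen i) :> 'S_(m + n).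
Proof.
apply/permP => x; apply: val_inj; rewrite sgenE; case: (split_ordP x) => k ->.
  rewrite block_perm_lshift perm1 /=; have := ltn_ord k.
  by case: eqP => [|_]; [lia|case: eqP => //; lia].
rewrite block_perm_rshift /= sgenE -addnS !eqn_add2l.
by case: ifP => // _; case: ifP.
Qed.

Lemma pdes_left x i : pdes x (gen_left n i) = pdes (perm_le x) i.
Proof.
rewrite /pdes (_ : gen_hi _ = lshift n (gen_hi i)); last exact: val_inj.
rewrite (_ : gen_lo _ = lshift n (gen_lo i)); last exact: val_inj.
by rewrite !perm_inv_lshift low_pos_mono.
Qed.

Lemma pdes_right x i : pdes x (gen_right m i) = pdes (perm_gt x) i.
Proof.
rewrite /pdes (_ : gen_hi _ = rshift m (gen_hi i)); last first.
  by apply: val_inj; rewrite /= addnS.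
rewrite (_ : gen_lo _ = rshift m (gen_lo i)); last exact: val_inj.
by rewrite !perm_inv_rshift high_pos_mono.
Qed.

(** As pi_i takes the basis vector x to the one indexed by dem i x, or to 0 if that
leaves the interval, this is the compatibility of the actions on bases. *)
Lemma dem_left x i :
  [/\ dem (gen_left n i) x @^-1: low m n = x @^-1: low m n,
      perm_le (dem (gen_left n i) x) = dem i (perm_le x) &
      perm_gt (dem (gen_left n i) x) = perm_gt x].
Proof.
rewrite /dem !DesLE pdes_left; case: ifP => _ //.
by rewrite sgen_left block_preim_low perm_le_block perm_gt_block mulg1.
Qed.

Lemma dem_right x i :
  [/\ dem (gen_right m i) x @^-1: low m n = x @^-1: low m n,
      perm_le (dem (gen_right m i) x) = perm_le x &
      perm_gt (dem (gen_right m i) x) = dem i (perm_gt x)].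
Proof.
rewrite /dem !DesLE pdes_right; case: ifP => _ //.
by rewrite sgen_right block_preim_low perm_le_block perm_gt_block mulg1.
Qed.

(** A low value is smaller than a high one, so the order of the values at a low
and at a high position is decided by the set of low positions. *)
Lemma invset_cross x y i j : x @^-1: low m n = y @^-1: low m n ->
  (i \in x @^-1: low m n) != (j \in x @^-1: low m n) ->
  ((i, j) \in invset x) = ((i, j) \in invset y).
Proof.
move=> e; have := e => /setP/(_ i); have := e => /setP/(_ j).
by rewrite !inE /=; lia.
Qed.

Lemma leL_blocks x y : x @^-1: low m n = y @^-1: low m n ->
  leL x y = leL (perm_le x) (perm_le y) && leL (perm_gt x) (perm_gt y).
Proof.
move=> e; rewrite !leLE; apply/subsetP/andP => [H|[/subsetP Hl /subsetP Hg]].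
  by split; apply/subsetP => -[j k]; rewrite ?(invset_perm_le, invset_perm_gt)
    ?(eq_low_pos e, eq_high_pos e); exact: H.
have lowE j : low_pos x j \in x @^-1: low m n by rewrite !inE low_pos_low /=.
have highE k : (high_pos x k \in x @^-1: low m n) = false.
  by rewrite !inE high_pos_high ltnNge leq_addr.
move=> [i j]; case: (block_posP x i) => i'; case: (block_posP x j) => j'.
- by rewrite -invset_perm_le => /Hl; rewrite invset_perm_le !(eq_low_pos e).
- by rewrite (invset_cross e) // lowE highE.
- by rewrite (invset_cross e) // lowE highE.
by rewrite -invset_perm_gt => /Hg; rewrite invset_perm_gt !(eq_high_pos e).
Qed.

(** * Intervals restricted to a set of low positions *)

Variable J : {set 'I_(m + n)}.
Implicit Types (sigma rho : 'S_(m + n)) (i j : 'I_(m + n)).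

Lemma sigma_sub_mono sigma i j : (i \in J) = (j \in J) ->
  (sigma_sub sigma J i < sigma_sub sigma J j) = (sigma i < sigma j).
Proof.
by move=> ij; rewrite !permM perm_sub_mono // !(mem_imset _ _ (@perm_inj _ sigma)).
Qed.

Lemma rho_sup_mono rho i j : (i \in J) = (j \in J) ->
  (rho_sup rho J i < rho_sup rho J j) = (rho i < rho j).
Proof.
move=> ij; rewrite ![rho_sup rho J _]permM perm_sup_mono; last first.
  by rewrite !(mem_imset _ _ (@perm_inj _ _)).
by rewrite !permM !permE /=; have := ltn_ord (rho i); have := ltn_ord (rho j); lia.
Qed.

Hypothesis cardJ : #|J| = m.

Lemma sigma_sub_low sigma : sigma_sub sigma J @^-1: low m n = J.
Proof.
have inj := @perm_inj _ sigma; apply/setP => i; rewrite !inE permM.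
by have := perm_sub_lt (sigma @: J) (sigma i); rewrite card_imset // cardJ mem_imset.
Qed.

Lemma rho_sup_low rho : rho_sup rho J @^-1: low m n = J.
Proof.
pose w := w0 (m + n) \po rho; have inj := @perm_inj _ w.
apply/setP => i; rewrite !inE [rho_sup rho J _]permM.
by have := perm_sup_lt (w @: J) (w i); rewrite card_imset // cardJ mem_imset.
Qed.

(** Inside a block sigma and sigma_J have the same inversions. Across the blocks,
those of sigma are inversions of g and those of sigma_J are the ones of g, and
x and g agree there; so the condition across the blocks holds on both sides. *)
Lemma leL_sigma_sub sigma g x :
  leL sigma g -> g @^-1: low m n = J -> x @^-1: low m n = J ->
  leL sigma x = leL (sigma_sub sigma J) x.
Proof.
move=> sg gJ xJ; have lowE := sigma_sub_low sigma.
rewrite !leLE; rewrite leLE in sg.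
apply/subsetP/subsetP => H [i j]; have [e|e] := eqVneq (i \in J) (j \in J).
- by rewrite invsetP sigma_sub_mono // -invsetP => /H.
- by rewrite (invset_cross (y := x)) ?lowE.
- by rewrite invsetP -(@sigma_sub_mono sigma) // -invsetP => /H.
by move=> /(subsetP sg); rewrite (invset_cross (y := x)) ?gJ ?xJ.
Qed.

(** Dual to [leL_sigma_sub]: across the blocks g forces the inversions of x to be
inversions of rho. *)
Lemma leL_rho_sup rho g x :
  leL g rho -> g @^-1: low m n = J -> x @^-1: low m n = J ->
  leL x rho = leL x (rho_sup rho J).
Proof.
move=> gr gJ xJ; have lowE := rho_sup_low rho.
rewrite !leLE; rewrite leLE in gr.
apply/subsetP/subsetP => H [i j]; have [e|e] := eqVneq (i \in J) (j \in J).
- by move=> /H; rewrite !invsetP rho_sup_mono.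
- by rewrite (invset_cross (y := rho_sup rho J)) ?lowE ?xJ.
- by move=> /H; rewrite !invsetP rho_sup_mono.
by rewrite (invset_cross (y := g)) ?gJ ?xJ // => /(subsetP gr).
Qed.

End BlockPermutations.

(** Membership of J in Sset provides the witness g that settles the inversions
across the blocks on both sides. *)
Lemma intervalL_blocks m n (J : {set 'I_(m + n)}) (sigma rho x : 'S_(m + n)) :
  J \in Sset sigma rho -> x @^-1: low m n = J ->
  (x \in intervalL sigma rho) =
  (perm_le x \in intervalL (perm_le (sigma_sub sigma J)) (perm_le (rho_sup rho J))) &&
  (perm_gt x \in intervalL (perm_gt (sigma_sub sigma J)) (perm_gt (rho_sup rho J))).
Proof.
rewrite inE => /andP[/eqP cardJ /existsP[g /andP[]]].
rewrite inE => /andP[sg gr] /eqP/esym gJ xJ.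
rewrite !inE (leL_sigma_sub cardJ sg gJ xJ) (leL_rho_sup cardJ gr gJ xJ).
by rewrite !leL_blocks ?sigma_sub_low ?rho_sup_low // andbACA.
Qed.

(** * Basis vectors indexed by all permutations *)

Section IntervalBasis.
Variables (K : fieldType) (N : nat) (sigma rho : 'S_N).
Local Open Scope ring_scope.

(** Extended by 0 outside the interval, the basis vectors are indexed by
permutations instead of elements of a type depending on sigma and rho. The
action formula then has no case distinction ([hgen_Bdelta]), and equal index
permutations in different summands can be rewritten into each other. *)
Definition Bdelta (x : 'S_N) : Bmod K sigma rho :=
  if insub x is Some g then Bbasis K g else 0.

Definition Bcoef (v : Bmod K sigma rho) (x : 'S_N) : K :=
  if insub x is Some g then (v : Bspace K sigma rho) g else 0.

Lemma Bdelta_val (g : interval_type sigma rho) : Bdelta (val g) = Bbasis K g.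
Proof. by rewrite /Bdelta valK. Qed.

Lemma Bdelta_out x : x \notin intervalL sigma rho -> Bdelta x = 0.
Proof. by move=> nx; rewrite /Bdelta insubN. Qed.

(** Above sigma, leaving the interval upwards is irreversible: if x is not below
rho, neither is dem i x, so both sides vanish. *)
Lemma hgen_Bdelta i x : leL sigma x -> hgen K i *: Bdelta x = Bdelta (dem i x).
Proof.
move=> sx; have [xI|nx] := boolP (x \in intervalL sigma rho).
  pose g : interval_type sigma rho := exist _ x xI.
  rewrite -[x]/(val g) Bdelta_val Bscale_gen.
  by rewrite /Bpi /dem; case: ifP => // _; rewrite -Bdelta_val.
rewrite !Bdelta_out ?scaler0 //; apply: contra nx; rewrite !inE sx /=.
by case/andP=> _; apply: leL_trans; exact: leL_dem.
Qed.

Lemma scale_scalar (c : K) (v : Bmod K sigma rho) :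
  (c%:A : hecke K N) *: v = (c *: (v : Bspace K sigma rho)).
Proof.
rewrite -hcstE; exact: (hecke_actE (@Bop_lin K N sigma rho)
  (@Bop_idem K N sigma rho) (@Bop_braid K N sigma rho) (@Bop_comm K N sigma rho)).
Qed.

Lemma Bdelta_sum (v : Bmod K sigma rho) :
  v = \sum_(g : interval_type sigma rho) ((Bcoef v (val g))%:A : hecke K N) *: Bdelta (val g).
Proof.
rewrite {1}[v]Bbasis_sum; apply: eq_bigr => g _.
by rewrite scale_scalar Bdelta_val /Bcoef valK.
Qed.

Lemma BcoefD u v x : Bcoef (u + v) x = Bcoef u x + Bcoef v x.
Proof. by rewrite /Bcoef; case: insub => [g|]; rewrite ?ffunE ?addr0. Qed.

Lemma BcoefZ c v x : Bcoef ((c%:A : hecke K N) *: v) x = c * Bcoef v x.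
Proof.
by rewrite scale_scalar /Bcoef; case: insub => [g|]; rewrite ?ffunE ?mulr0.
Qed.

Lemma Bcoef_delta x y : x \in intervalL sigma rho -> Bcoef (Bdelta y) x = (x == y)%:R.
Proof.
move=> xI; rewrite /Bcoef insubT /Bdelta; case: insubP => [g _ <-|nx].
  by rewrite ffunE -val_eqE.
by rewrite ffunE; case: eqP => // e; rewrite -e xI in nx.
Qed.

End IntervalBasis.

(** * Zero tensors and coordinates of direct sums *)

Section TensorZero.
Variables (K : fieldType) (V W : lmodType K).
Local Open Scope ring_scope.

Lemma pure0l (w : W) : pure (0 : V) w = 0.
Proof. by rewrite -(scale0r (0 : V)) pureZl scale0r. Qed.

Lemma pure0r (v : V) : pure v (0 : W) = 0.
Proof. by rewrite -(scale0r (0 : W)) pureZr scale0r. Qed.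

End TensorZero.

Section DirectSumCoordinates.
Variables (A : pzRingType) (I : finType) (M : I -> lmodType A).
Implicit Types f g : dsum M.
Local Open Scope ring_scope.

Lemma dsum_coordZ (t : A) f i : dsum_coord (t *: f) i = t *: dsum_coord f i.
Proof. exact: dsum_mkE. Qed.

Lemma dsum_coordD f g i : dsum_coord (f + g) i = dsum_coord f i + dsum_coord g i.
Proof. exact: dsum_mkE. Qed.

Lemma dsum_coord0 i : dsum_coord (0 : dsum M) i = 0.
Proof. exact: dsum_mkE. Qed.

End DirectSumCoordinates.

(** * The isomorphism *)

Section RestrictionIso.
Variables (K : fieldType) (m n : nat) (sigma rho : 'S_(m + n)).
Local Open Scope ring_scope.
Local Notation I := {J : {set 'I_(m + n)} | J \in Sset sigma rho}.
Local Notation B := (Bmod K sigma rho).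
Local Notation L J := (Bmod K (perm_le (sigma_sub sigma J)) (perm_le (rho_sup rho J))).
Local Notation R J := (Bmod K (perm_gt (sigma_sub sigma J)) (perm_gt (rho_sup rho J))).
Local Notation T J := (otens (L J) (R J)).
Implicit Types x y : 'S_(m + n).
Local Notation lowset x := (x @^-1: low m n).
Local Notation HH := (atens (hecke K m) (hecke K n)).
Local Notation source := (restr (@hecke_incl K m n) B).
Local Notation target := (dsum (fun J : I => otens (L (val J)) (R (val J)))).

Definition Tdelta (J : {set 'I_(m + n)}) (x : 'S_(m + n)) : T J :=
  pure (Bdelta _ _ _ (perm_le x) : uspace (L J)) (Bdelta _ _ _ (perm_gt x) : uspace (R J)).

(** The base field inside H_m(0) (x) H_n(0): scalars of the modules involved are
only available through the algebras that act on them. *)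
Definition scal (c : K) : HH := pure c%:A 1.

(** The linear map taking the basis vector g to the tensor product of perm_le g and
perm_gt g in the summand of its set of low positions, written coordinate by
coordinate. *)
Definition split_map (v : source) : target :=
  dsum_mk (fun J : I => \sum_(g : interval_type sigma rho | lowset (val g) == val J)
    scal (Bcoef (v : B) (val g)) *: Tdelta (val J) (val g)).

Lemma hecke_incl_left (a : hecke K m) (v : source) :
  ((pure a 1 : HH) *: v) = hecke_left n a *: (v : B).
Proof.
transitivity ((hecke_incl (pure a 1) : hecke K (m + n)) *: (v : B)); first by [].
by rewrite hecke_incl_pure hecke_right1 mulr1.
Qed.

Lemma hecke_incl_right (b : hecke K n) (v : source) :
  ((pure 1 b : HH) *: v) = hecke_right m b *: (v : B).
Proof.
transitivity ((hecke_incl (pure 1 b) : hecke K (m + n)) *: (v : B)); first by [].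
by rewrite hecke_incl_pure hecke_left1 mul1r.
Qed.

Lemma scal_source c (v : source) : scal c *: v = (c%:A : hecke K (m + n)) *: (v : B).
Proof. by rewrite hecke_incl_left hecke_leftZ hecke_left1. Qed.

Lemma scalD c d : scal (c + d) = scal c + scal d.
Proof. by rewrite /scal scalerDl pureDl. Qed.

Lemma scalM c d : scal (c * d) = scal c * scal d.
Proof. by rewrite [RHS]amul_pure mulr1 -scalerAl mul1r scalerA. Qed.

Lemma scal0 : scal 0 = 0.
Proof. by apply: (addrI (scal 0)); rewrite -scalD !addr0. Qed.

Lemma scal1 : scal 1 = 1.
Proof. by rewrite /scal scale1r. Qed.

Lemma scal_central c (t : HH) : scal c * t = t * scal c.
Proof.
elim/tens_ind: t => [|t u ht hu|a b]; first by rewrite mulr0 mul0r.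
  by rewrite mulrDl mulrDr ht hu.
rewrite [LHS]amul_pure [RHS]amul_pure mul1r mulr1.
by rewrite mulr_algl mulr_algr.
Qed.

Lemma scal_pure J c (v : L J) (w : R J) :
  scal c *: (pure (v : uspace (L J)) (w : uspace (R J)) : T J) =
  pure ((c%:A *: v : L J) : uspace (L J)) (w : uspace (R J)).
Proof. by rewrite [LHS]otens_scale_pure uact1. Qed.

Lemma split_mapD (u v : source) : split_map (u + v) = split_map u + split_map v.
Proof.
apply: dsumP => J; rewrite dsum_coordD !dsum_mkE -big_split /=.
by apply: eq_bigr => g _; rewrite -scalerDl -scalD BcoefD.
Qed.

Lemma split_map0 : split_map 0 = 0.
Proof. by apply: (addrI (split_map 0)); rewrite -split_mapD !addr0. Qed.

Lemma split_map_scal c (v : source) : split_map (scal c *: v) = scal c *: split_map v.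
Proof.
apply: dsumP => J; rewrite scal_source dsum_coordZ !dsum_mkE scaler_sumr.
by apply: eq_bigr => g _; rewrite BcoefZ scalM scalerA.
Qed.

Lemma Tdelta_out (J : I) x : lowset x = val J -> x \notin intervalL sigma rho ->
  Tdelta (val J) x = 0.
Proof.
move=> xJ; rewrite (intervalL_blocks (valP J) xJ) negb_and.
rewrite /Tdelta => /orP[] /Bdelta_out ->.
  exact: pure0l.
exact: pure0r.
Qed.

(** The formula also holds for x outside the interval: if J is the set of low
positions of x, then one of the two patterns lies outside its interval, by
[intervalL_blocks], and both sides vanish. *)
Lemma split_map_delta x (J : I) :
  dsum_coord (split_map (Bdelta K sigma rho x : B)) J =
  if lowset x == val J then Tdelta (val J) x else 0.
Proof.
rewrite dsum_mkE; have [xI|nx] := boolP (x \in intervalL sigma rho); last first.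
  rewrite Bdelta_out // big1 => [|g _]; last first.
    by rewrite /Bcoef insubT ?(valP g) // => p; rewrite ffunE scal0 scale0r.
  by case: eqP => // /Tdelta_out ->.
pose g := exist _ x xI : interval_type sigma rho.
rewrite -[x]/(val g); case: ifP => e.
  rewrite (bigD1 g) //= Bcoef_delta // eqxx scal1 scale1r big1 ?addr0 //.
  move=> h /andP[_ hg]; have hx : (val h == x) = false.
    by rewrite -[x]/(val g) val_eqE (negbTE hg).
  by rewrite Bcoef_delta ?(valP h) // hx scal0 scale0r.
rewrite big1 // => h eh; rewrite Bcoef_delta ?(valP h) //.
by case: eqP => [hg|_]; rewrite ?scal0 ?scale0r //; rewrite hg e in eh.
Qed.

Definition equivariant (t : HH) := forall v : source, split_map (t *: v) = t *: split_map v.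

(** Scalars being central, it suffices to test one algebra element on a basis. *)
Lemma equivariant_delta t :
  (forall g : interval_type sigma rho,
     split_map (t *: (Bdelta K sigma rho (val g) : source)) =
     t *: split_map (Bdelta K sigma rho (val g))) -> equivariant t.
Proof.
move=> H v; rewrite (Bdelta_sum v).
have P0 : split_map (t *: (0 : source)) = t *: split_map 0.
  by rewrite scaler0 split_map0 scaler0.
apply: (big_ind (fun u : B => split_map (t *: (u : source)) = t *: split_map u)) => //.
  by move=> u w hu hw; rewrite [t *: _]scalerDr !split_mapD hu hw scalerDr.
move=> g _; rewrite -(scal_source _ (Bdelta K sigma rho (val g) : source)).
by rewrite scalerA -scal_central -scalerA !split_map_scal H !scalerA scal_central.
Qed.

Lemma equivariantD t u : equivariant t -> equivariant u -> equivariant (t + u).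
Proof. by move=> ht hu v; rewrite !scalerDl split_mapD ht hu. Qed.

Lemma equivariantM t u : equivariant t -> equivariant u -> equivariant (t * u).
Proof. by move=> ht hu v; rewrite -!scalerA ht hu. Qed.

Lemma equivariant_scal c : equivariant (scal c).
Proof. by move=> v; exact: split_map_scal. Qed.

Lemma Tdelta_dem_left (J : I) x i : lowset x = val J -> x \in intervalL sigma rho ->
  Tdelta (val J) (dem (gen_left n i) x) =
  (pure (hgen K i) 1 : HH) *: Tdelta (val J) x.
Proof.
move=> xJ; rewrite (intervalL_blocks (valP J) xJ) !inE => /andP[/andP[sx _] _]; rewrite /Tdelta.
have [_ -> ->] := dem_left x i.
by rewrite [RHS]otens_scale_pure uact1 /uact hgen_Bdelta.
Qed.

Lemma Tdelta_dem_right (J : I) x i : lowset x = val J -> x \in intervalL sigma rho ->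
  Tdelta (val J) (dem (gen_right m i) x) =
  (pure 1 (hgen K i) : HH) *: Tdelta (val J) x.
Proof.
move=> xJ; rewrite (intervalL_blocks (valP J) xJ) !inE => /andP[_ /andP[sx _]]; rewrite /Tdelta.
have [_ -> ->] := dem_right x i.
by rewrite [RHS]otens_scale_pure uact1 /uact hgen_Bdelta.
Qed.

Lemma equivariant_gen_left i : equivariant (pure (hgen K i) 1).
Proof.
apply: equivariant_delta => g; have gI := valP g.
have sg : leL sigma (val g) by move: gI; rewrite inE => /andP[].
rewrite hecke_incl_left hecke_left_gen hgen_Bdelta //; apply: dsumP => J.
have [e _ _] := dem_left (val g) i.
rewrite dsum_coordZ !split_map_delta e.
by case: eqP => [eJ|_]; [exact: Tdelta_dem_left | rewrite scaler0].
Qed.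

Lemma equivariant_gen_right i : equivariant (pure 1 (hgen K i)).
Proof.
apply: equivariant_delta => g; have gI := valP g.
have sg : leL sigma (val g) by move: gI; rewrite inE => /andP[].
rewrite hecke_incl_right hecke_right_gen hgen_Bdelta //; apply: dsumP => J.
have [e _ _] := dem_right (val g) i.
rewrite dsum_coordZ !split_map_delta e.
by case: eqP => [eJ|_]; [exact: Tdelta_dem_right | rewrite scaler0].
Qed.

(** The elements for which [split_map] is equivariant form a subalgebra, and
H_m(0) (x) H_n(0) is generated by the pi_i (x) 1 and the 1 (x) pi_j. *)
Lemma equivariant_all t : equivariant t.
Proof.
have left a : equivariant (pure a 1).
  elim/hecke_ind: a => [i|c|a b ha hb|a b ha hb].
  - exact: equivariant_gen_left.
  - exact: equivariant_scal.
  - by rewrite pureDl; exact: equivariantD.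
  by rewrite -[1]mulr1 -[pure _ _]amul_pure; exact: equivariantM.
have right b : equivariant (pure 1 b).
  elim/hecke_ind: b => [i|c|a b ha hb|a b ha hb].
  - exact: equivariant_gen_right.
  - by rewrite pureZr -pureZl; exact: equivariant_scal.
  - by rewrite pureDr; exact: equivariantD.
  by rewrite -[1]mulr1 -[pure _ _]amul_pure; exact: equivariantM.
elim/tens_ind: t => [|t u ht hu|a b].
- by move=> v; rewrite !scale0r split_map0.
- exact: equivariantD.
by rewrite -[a]mulr1 -[b]mul1r -[pure _ _]amul_pure; exact: equivariantM.
Qed.

(** The coefficient of a (x) b in a tensor. *)
Definition eval_pair (J : {set 'I_(m + n)}) (a : 'S_m) (b : 'S_n) (t : T J) : K :=
  tens_lift (fun (v : uspace (L J)) (w : uspace (R J)) => Bcoef (v : L J) a * Bcoef (w : R J) b) t.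

Lemma eval_pair_hyps J a b :
  [/\ forall (v v' : uspace (L J)) (w : uspace (R J)),
        Bcoef (v + v' : L J) a * Bcoef (w : R J) b =
        Bcoef (v : L J) a * Bcoef (w : R J) b + Bcoef (v' : L J) a * Bcoef (w : R J) b,
      forall (v : uspace (L J)) (w w' : uspace (R J)),
        Bcoef (v : L J) a * Bcoef (w + w' : R J) b =
        Bcoef (v : L J) a * Bcoef (w : R J) b + Bcoef (v : L J) a * Bcoef (w' : R J) b &
      forall c (v : uspace (L J)) (w : uspace (R J)),
        Bcoef (c *: v : L J) a * Bcoef (w : R J) b =
        Bcoef (v : L J) a * Bcoef (c *: w : R J) b].
Proof.
split=> [v v' w|v w w'|c v w]; first by rewrite BcoefD mulrDl.
  by rewrite BcoefD mulrDr.
rewrite [X in X * _ = _](BcoefZ c (v : L J)) [X in _ = _ * X](BcoefZ c (w : R J)).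
by rewrite mulrCA mulrA.
Qed.

Lemma eval_pairD J a b : {morph @eval_pair J a b : t u / t + u}.
Proof. by have [h1 h2 h3] := eval_pair_hyps J a b; exact: tens_liftD. Qed.

Lemma eval_pair0 J a b : @eval_pair J a b 0 = 0.
Proof. by have [h1 h2 h3] := eval_pair_hyps J a b; exact: tens_lift0. Qed.

Lemma eval_pair_pure J a b v w :
  @eval_pair J a b (pure v w) = Bcoef (v : L J) a * Bcoef (w : R J) b.
Proof. by have [h1 h2 h3] := eval_pair_hyps J a b; exact: tens_lift_pure. Qed.

(** Different permutations with the same low positions have different pairs of
patterns, so reading the coefficient at the patterns of x detects x. *)
Lemma eval_pair_Tdelta J c x y :
  J \in Sset sigma rho -> lowset x = J -> lowset y = J -> x \in intervalL sigma rho ->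
  eval_pair (perm_le x) (perm_gt x) (scal c *: Tdelta J y) = c * (x == y)%:R.
Proof.
move=> JS xJ yJ; rewrite (intervalL_blocks JS xJ).
move=> /andP[xl xg]; rewrite scal_pure eval_pair_pure BcoefZ !Bcoef_delta //.
rewrite -mulrA -natrM mulnb; congr (_ * (nat_of_bool _)%:R).
apply/andP/eqP => [[/eqP el /eqP eg]|->]; last by rewrite !eqxx.
by apply: perm_block_inj el eg; rewrite xJ -yJ.
Qed.

Lemma lowset_Sset x : x \in intervalL sigma rho -> lowset x \in Sset sigma rho.
Proof.
move=> xI; rewrite inE -card_low_preim eqxx /=.
by apply/existsP; exists x; rewrite xI eqxx.
Qed.

(** A left inverse of [split_map], because g is determined by its low positions,
which select the summand, and by its patterns, which select the coefficient. *)
Definition split_inv (f : target) : source :=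
  [ffun g : interval_type sigma rho =>
    eval_pair (perm_le (val g)) (perm_gt (val g))
      (dsum_coord f (exist _ (lowset (val g)) (lowset_Sset (valP g))))] : Bspace K sigma rho.

Lemma split_mapK : cancel split_map split_inv.
Proof.
move=> v; apply/ffunP => g; rewrite ffunE dsum_mkE.
rewrite (big_morph _ (@eval_pairD _ _ _) (@eval_pair0 _ _ _)) (bigD1 g) //=.
rewrite eval_pair_Tdelta ?lowset_Sset ?(valP g) // eqxx mulr1 /Bcoef valK big1 ?addr0 //.
move=> h /andP[/eqP hJ hg]; rewrite eval_pair_Tdelta ?lowset_Sset ?(valP g) //.
by rewrite val_eqE eq_sym (negbTE hg) mulr0.
Qed.

(** A preimage of t placed in the summand J alone; the other coordinates are
spelled out to avoid transporting t between summands. *)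
Definition has_lift (J : I) (t : T (val J)) := exists v : source,
  dsum_coord (split_map v) J = t /\
  forall J' : I, J' != J -> dsum_coord (split_map v) J' = 0.

Lemma has_lift0 (J : I) : has_lift (0 : T (val J)).
Proof.
by exists 0; split=> [|J' _]; rewrite split_map0 dsum_coord0.
Qed.

Lemma has_liftD (J : I) (t u : T (val J)) : has_lift t -> has_lift u -> has_lift (t + u).
Proof.
move=> [v [vJ v0]] [w [wJ w0]]; exists (v + w).
split=> [|J' nJ]; rewrite split_mapD dsum_coordD ?vJ ?wJ //.
by rewrite v0 // w0 // addr0.
Qed.

(** This is where the two intervals are seen to be fully reached: any two
permutations are the patterns of some x with the prescribed low positions. *)
Lemma has_lift_basis (J : I) c d (a : 'S_m) (b : 'S_n) :
  has_lift (pure ((c%:A : hecke K m) *: (Bdelta K _ _ a) : uspace (L (val J)))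
            ((d%:A : hecke K n) *: (Bdelta K _ _ b) : uspace (R (val J))) : T (val J)).
Proof.
have := valP J; rewrite inE => /andP[_ /existsP[g /andP[_ /eqP gJ]]].
have [x [xJ xa xb]] := perm_with_blocks g a b.
exists (scal (c * d) *: (Bdelta K sigma rho x : source)).
split=> [|J' nJ]; rewrite split_map_scal dsum_coordZ split_map_delta xJ -gJ.
  rewrite eqxx mulrC scalM -scalerA /Tdelta xa xb scal_pure.
  by rewrite [LHS]otens_scale_pure uact1 pureZr -pureZl.
by rewrite eq_sym val_eqE (negbTE nJ) scaler0.
Qed.

Lemma has_lift_all (J : I) (t : T (val J)) : has_lift t.
Proof.
elim/tens_ind: t => [|t u|v w]; [exact: has_lift0 | exact: has_liftD |].
rewrite (Bdelta_sum (v : L (val J))).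
apply: (big_ind (fun v' : L (val J) =>
  has_lift (pure (v' : uspace (L (val J))) w : T (val J)))).
- by rewrite pure0l; exact: has_lift0.
- by move=> u u' hu hu'; rewrite pureDl; exact: has_liftD.
move=> a _; rewrite (Bdelta_sum (w : R (val J))).
apply: (big_ind (fun w' : R (val J) =>
  has_lift (pure (_ : uspace (L (val J))) (w' : uspace (R (val J))) : T (val J)))).
- by rewrite pure0r; exact: has_lift0.
- by move=> u u' hu hu'; rewrite pureDr; exact: has_liftD.
by move=> b _; exact: has_lift_basis.
Qed.

Lemma split_map_surj (f : target) : exists v, f = split_map v.
Proof.
have [v vP] := fin_all_exists (fun J => has_lift_all (dsum_coord f J)).
exists (\sum_J v J); apply: dsumP => J.
rewrite (big_morph _ split_mapD split_map0).
rewrite (big_morph (fun f => dsum_coord f J) (fun f g => dsum_coordD f g J) (dsum_coord0 _ J)).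
rewrite (bigD1 J) //= (vP J).1 big1 ?addr0 // => J' nJ.
by rewrite (vP J').2 // eq_sym.
Qed.

Lemma split_map_linear : linear split_map.
Proof. by move=> t u v; rewrite split_mapD equivariant_all. Qed.

HB.instance Definition _ := GRing.isLinear.Build HH source target *:%R split_map split_map_linear.

Theorem restriction_iso : module_iso source target.
Proof.
exists split_map; exists split_inv; first exact: split_mapK.
by move=> f; have [v ->] := split_map_surj f; rewrite split_mapK.
Qed.

End RestrictionIso.

Theorem theorem3p12 (R : realType) (m n : nat) (hm : (0 < m)%N) (hn : (0 < n)%N)
    (sigma rho : 'S_(m + n)) :
  module_iso
    (restr (@hecke_incl R[i] m n) (Bmod R[i] sigma rho))
    (dsum (fun J : {J : {set 'I_(m + n)} | J \in Sset sigma rho} =>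
       otens
         (Bmod R[i] (perm_le (sigma_sub sigma (val J)))
                    (perm_le (rho_sup rho (val J))))
         (Bmod R[i] (perm_gt (sigma_sub sigma (val J)))
                    (perm_gt (rho_sup rho (val J)))))).
Proof. exact: restriction_iso. Qed.
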